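(* Let $\Omega\subset\mathbb{R}$ be a finite union of closed bounded intervals, let $w>0$ be a positive continuous weight function on $\Omega$, let $0<\alpha<1$, $1\leq p\leq\infty$, $m\geq 2$ an integer, and let $F\in C(\Omega)$. Define $d:=\inf_{q\in W^{\alpha,p}(w,\Omega)}\|q-F\|_{\mathrm{L}^p(w,\Omega)}$. Then $$d=\inf_{q\in W^{m,p}(w,\Omega)}\|q-F\|_{\mathrm{L}^p(w,\Omega)}.$$
   Context: $\mathbb{C}^+=\{z\in\mathbb{C}:\Im z>0\}$. A Herglotz function is an analytic $h\colon\mathbb{C}^+\to\mathbb{C}$ with $\Im h\geq 0$; a quasi-Herglotz function is an analytic $q\colon\mathbb{C}^+\to\mathbb{C}$ with $q=h_1-h_2$ for Herglotz functions $h_1,h_2$. $C(\Omega)$ is the space of complex-valued continuous functions on $\Omega$. $\mathrm{L}^p(w,\Omega)$ is the Banach space with norm $\|f\|=(\int_\Omega w|f|^p\,\mathrm{d}x)^{1/p}$ for $p<\infty$, and the essential supremum of $w|f|$ for $p=\infty$. $C^{0,\alpha}(\Omega)$ is the space of complex-valued Hölder continuous functions with exponent $\alpha$ on $\Omega$. $W^{\alpha,p}(w,\Omega)\subset\mathrm{L}^p(w,\Omega)$ is the set of all complex-valued $q\in C^{0,\alpha}(\Omega)$ such that there exists a quasi-Herglotz function which has a Hölder continuous (exponent $\alpha$) extension to $\mathbb{C}^+\cup\overline{\mathcal{O}}$ for some open neighborhood $\mathcal{O}$ of $\Omega$, coinciding with $q$ on $\Omega$. $W^{m,p}(w,\Omega)\subset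 W^{\alpha,p}(w,\Omega)$ is the subset of those functions for which this quasi-Herglotz function can be written as $q(z)=a+bz+\int_\mathbb{R}\left(\frac{1}{\xi-z}-\frac{\xi}{1+\xi^2}\right)\mathrm{d}\beta(\xi)$ ($a,b\in\mathbb{R}$) with a signed Borel measure $\beta$ that is absolutely continuous with density $\beta'$ equal to a finite uniform B-spline expansion of order $m$, i.e. a finite linear combination of B-splines of order $m$ (compactly supported, piecewise polynomial of degree $m-1$, each defined by $m+1$ break-points) with equidistant break-points. *)

(* Defs.v *)
From HB Require Import structures.
From mathcomp Require Import all_boot all_order all_algebra.
From mathcomp Require Import all_classical all_reals all_analysis.
From mathcomp Require Import complex.
Set Implicit Arguments.
Unset Strict Implicit.
Unset Printing Implicit Defensive.
Import Order.TTheory GRing.Theory Num.Theory.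
Import numFieldNormedType.Exports.
Local Open Scope classical_set_scope.
Local Open Scope ring_scope.

Section QH.
Variable R : realType.
Local Notation C := R[i].
Local Notation mu := (@lebesgue_measure R).

Definition cabs (z : C) : R := Normc.normc z.

Definition UHP : set C := [set z | 0 < complex.Im z].

Definition Omega_of (s : seq (R * R)) : set R :=
  [set x | has (fun ab => (ab.1 <= x) && (x <= ab.2)) s].

Definition holomorphic_UHP (f : C -> C) : Prop :=
  forall z, UHP z -> derivable (f : C^o -> C^o) z 1.

Definition Herglotz (h : C -> C) : Prop :=
  holomorphic_UHP h /\ (forall z, UHP z -> 0 <= complex.Im (h z)).

Definition quasi_Herglotz (q : C -> C) : Prop :=
  exists h1 h2, Herglotz h1 /\ Herglotz h2 /\
    (forall z, UHP z -> q z = h1 z - h2 z).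

Definition Holder_on (A : set R) (al : R) (f : R -> C) : Prop :=
  exists L : R, forall x y, A x -> A y ->
    cabs (f x - f y) <= L * powR `|x - y| al.

Definition loc_Holder_on (E : set C) (al : R) (f : C -> C) : Prop :=
  forall r : R, exists L : R, forall z1 z2, E z1 -> E z2 ->
    cabs z1 <= r -> cabs z2 <= r ->
    cabs (f z1 - f z2) <= L * powR (cabs (z1 - z2)) al.

Definition UHP_cl (O : set R) : set C :=
  [set z | UHP z \/ (complex.Im z = 0 /\ closure O (complex.Re z))].

Definition QH_Holder_ext (Om : set R) (al : R) (q : R -> C) (Q : C -> C) :=
  quasi_Herglotz Q /\
  exists O : set R, open O /\ Om `<=` O /\
    exists Qe : C -> C, (forall z, UHP z -> Qe z = Q z) /\
      loc_Holder_on (UHP_cl O) al Qe /\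
      (forall x, Om x -> Qe x%:C%C = q x).

Definition W_alpha (Om : set R) (al : R) (q : R -> C) : Prop :=
  Holder_on Om al q /\ exists Q, QH_Holder_ext Om al q Q.

(* cardinal B-spline of order j (degree j-1) with knots 0,1,...,j
   (Cox--de Boor recursion) *)
Fixpoint cardB (j : nat) (x : R) : R :=
  match j with
  | 0%N => 0
  | 1%N => if (0 <= x) && (x < 1) then 1 else 0
  | j'.+1 => (x * cardB j' x + (j'.+1%:R - x) * cardB j' (x - 1)) / j'%:R
  end.

(* finite uniform B-spline expansion of order m: linear combination of the
   B-splines of order m with break-points t0 + (k + l) h, l = 0..m *)
Definition uniform_Bspline_expansion (m : nat) (g : R -> R) : Prop :=
  exists (t0 h : R) (n : nat) (c : 'I_n -> R), 0 < h /\
    forall x, g x = \sum_(k < n) c k * cardB m ((x - t0) / h - k%:R).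

Definition cintegral (f : R -> C) : C :=
  ((Rintegral mu setT (fun x => complex.Re (f x)))%:C
   + 'i * (Rintegral mu setT (fun x => complex.Im (f x)))%:C)%C.

Definition cintegrable (f : R -> C) : Prop :=
  mu.-integrable setT (fun x => (complex.Re (f x))%:E) /\
  mu.-integrable setT (fun x => (complex.Im (f x))%:E).

Definition Bspline_repr (m : nat) (Q : C -> C) : Prop :=
  exists (a b : R) (beta' : R -> R), uniform_Bspline_expansion m beta' /\
    forall z, UHP z ->
      let g := fun xi : R =>
        ((1 / (xi%:C - z) - (xi / (1 + xi ^+ 2))%:C) * (beta' xi)%:C)%C in
      cintegrable g /\ Q z = (a%:C + b%:C * z + cintegral g)%C.

Definition W_m (Om : set R) (al : R) (m : nat) (q : R -> C) : Prop :=
  Holder_on Om al q /\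
  exists Q, QH_Holder_ext Om al q Q /\ Bspline_repr m Q.

Definition Lp_norm (Om : set R) (w : R -> R) (p : \bar R) (f : R -> C)
  : \bar R :=
  match p with
  | r%:E => ((\int[mu]_(x in Om) (w x * powR (cabs (f x)) r)%:E) `^ r^-1)%E
  | +oo%E => ereal_inf [set y : \bar R |
               {ae mu, forall x, Om x -> ((w x * cabs (f x))%:E <= y)%E}]
  | -oo%E => 0%E
  end.

Definition dist_to (S : (R -> C) -> Prop) (Om : set R) (w : R -> R)
  (p : \bar R) (F : R -> C) : \bar R :=
  ereal_inf [set Lp_norm Om w p (fun x => (q x - F x)%C) | q in S].

End QH.

(* Main.v *)
(** Both infima vanish, unless [Omega] is null and [p = +oo], when both are
[-oo]: every continuous [F] on [Omega] is a uniform limit of boundary values of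
Cauchy transforms of B-spline expansions on one uniform grid.  The imaginary part of
such a boundary value is [pi] times the density, so a quasi-interpolant on a fine
grid matches [Im F].  The remaining real error is corrected by splines of the
same grid supported to the right of [Omega], whose Cauchy transforms are real on
[Omega]: expanding [1 / (xi - x)] in powers of [x / xi] shows that their closed
span contains all monomials, hence all real continuous functions.

The Cauchy transforms are explicit: they satisfy the Cox--de Boor recursion, started
from a difference of two logarithms, which yields their Hölder regularity up to
the real line. *)

Require Import Defs.
From HB Require Import structures.
From mathcomp Require Import all_boot all_order all_algebra.
From mathcomp Require Import all_classical all_reals all_analysis.
From mathcomp Require Import complex.
From mathcomp Require Import measurable_realfun.
From mathcomp Require Import ring lra.
Import Order.TTheory GRing.Theory Num.Theory.
Import numFieldNormedType.Exports.
Local Open Scope classical_set_scope.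
Local Open Scope ring_scope.

Set Implicit Arguments.
Unset Strict Implicit.
Unset Printing Implicit Defensive.

(** * Integrals *)

(** The imaginary part dictates the mesh, which must follow the modulus of continuity of Im F. What
    remains free is that the grid extends to infinity. For a spline near a point X far to the right,
    the Taylor coefficient of degree j has order X^(-j-1), and the truncation error after degree J,
    relative to the coefficient of degree J, is at most M^(J+1) / (X - M) on [- M, M]. It tends to 0
    with growing X, so monomials are reached one degree at a time, each modulo the lower ones. Order
    at least 2 is what makes the boundary values regular: an order-one B-spline has a transform with
    logarithmic singularities, whereas from order 2 on only z log z enters, which is locally Hölder
    for every exponent below 1. *)

Section HasIntegral.
Variable R : realType.
Local Notation C := R[i].
Local Notation mu := (@lebesgue_measure R).

(** Integrability is paired with the value: the final representation demands both, and each
    linearity rule for the value needs the former. *)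
Definition has_int (f : R -> R) (v : R) : Prop :=
  mu.-integrable setT (EFin \o f) /\ Rintegral mu setT f = v.

Implicit Type v : R.

Lemma has_int_ext (f g : R -> R) v : f =1 g -> has_int f v -> has_int g v.
Proof. by move=> /funext <-. Qed.

Lemma has_intD (f g : R -> R) u v : has_int f u -> has_int g v ->
  has_int (fun x => f x + g x) (u + v).
Proof.
move=> [fi <-] [gi <-]; split; last by rewrite RintegralD.
rewrite (_ : _ \o _ = (EFin \o f) \+ (EFin \o g))%E; first exact: integrableD.
by apply/funext => x; rewrite /= EFinD.
Qed.

Lemma has_intZ (f : R -> R) c v : has_int f v -> has_int (fun x => c * f x) (c * v).
Proof.
move=> [fi <-]; split; last by rewrite RintegralZl.
rewrite (_ : _ \o _ = (fun x => c%:E * (EFin \o f) x)%E); first exact: integrableZl.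
by apply/funext => x; rewrite /= EFinM.
Qed.

Lemma has_intB (f g : R -> R) u v : has_int f u -> has_int g v ->
  has_int (fun x => f x - g x) (u - v).
Proof.
move=> fu gv; rewrite -[- v]mulN1r; apply: has_int_ext (has_intD fu (has_intZ (-1) gv)).
by move=> x; rewrite mulN1r.
Qed.

Lemma has_int0 : has_int (fun=> 0) 0.
Proof.
split; last by rewrite /Rintegral integral0_eq//.
exact: integrable0.
Qed.

Lemma has_int_sum (I : Type) (r : seq I) (f : I -> R -> R) (v : I -> R) :
  (forall i, has_int (f i) (v i)) ->
  has_int (fun x => \sum_(i <- r) f i x) (\sum_(i <- r) v i).
Proof.
move=> fv; elim: r => [|i r IH].
  rewrite big_nil; apply: has_int_ext has_int0 => x; by rewrite big_nil.
rewrite big_cons; apply: has_int_ext (has_intD (fv i) IH) => x.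
by rewrite big_cons.
Qed.

Lemma has_int_ge0 (f : R -> R) v : (forall x, 0 <= f x) -> has_int f v -> 0 <= v.
Proof. by move=> f0 [_ <-]; apply: Rintegral_ge0. Qed.

Lemma has_int_le (f g : R -> R) u v : (forall x, f x <= g x) ->
  has_int f u -> has_int g v -> u <= v.
Proof.
move=> fg fu gv; rewrite -subr_ge0; apply: has_int_ge0 (has_intB gv fu) => x.
by rewrite subr_ge0.
Qed.

Lemma has_int_norm_le (f g : R -> R) u v : (forall x, `|f x| <= g x) ->
  has_int f u -> has_int g v -> `|u| <= v.
Proof.
move=> fg fu gv; rewrite ler_norml; apply/andP; split.
- rewrite -mulN1r; apply: has_int_le (has_intZ (-1) gv) fu => x.
  by have := fg x; rewrite mulN1r ler_norml => /andP[].
- by apply: has_int_le fu gv => x; apply: le_trans (fg x); exact: ler_norm.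
Qed.

Lemma has_int_dominated (f g : R -> R) v : measurable_fun setT f ->
  (forall x, `|f x| <= g x) -> has_int g v -> exists u, has_int f u.
Proof.
move=> mf fg [gi _]; exists (Rintegral mu setT f); split=> //.
apply: le_integrable gi => //; first exact/measurable_EFinP.
move=> x _ /=; rewrite lee_fin (le_trans (fg x))//; exact: ler_norm.
Qed.

Lemma has_int_measurable (f : R -> R) v : has_int f v -> measurable_fun setT f.
Proof. by move=> [/measurable_int/measurable_EFinP]. Qed.

(** The fundamental theorem of calculus on a half-open cell, the shape of the support of
    [cardB 1]. *)
Lemma has_int_cell (A B : R) (f G : R -> R) : A < B ->
  (forall x, A <= x <= B -> is_derive x 1 G (f x)) ->
  (forall x, A <= x <= B -> {for x, continuous f}) ->
  has_int (fun x => if (A <= x) && (x < B) then f x else 0) (G B - G A).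
Proof.
move=> AB dG cf.
have cfw : {within `[A, B], continuous f}.
  by apply: continuous_in_subspaceT => x; rewrite inE/= in_itv/= => /cf.
have ifc : mu.-integrable `[A, B] (EFin \o f).
  by apply: continuous_compact_integrable => //; exact: segment_compact.
have ifo : mu.-integrable `[A, B[ (EFin \o f).
  by apply: integrableS ifc => //; apply: subset_itvl; rewrite bnd_simp.
have E : (fun x => if (A <= x) && (x < B) then f x else 0) = f \_ `[A, B[.
  by apply/funext => x; rewrite patchE mem_setE in_itv/=.
rewrite E; split.
  rewrite -restrict_EFin; apply/integrable_restrict => //; by rewrite setTI.
rewrite -Rintegral_mkcond Rintegral_itv_bndo_bndc// /Rintegral.
have cG x : A <= x <= B -> {for x, continuous G}.
  move=> /dG [dx _]; exact/differentiable_continuous/derivable1_diffP.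
rewrite (@continuous_FTC2 _ f G)//.
- split.
  + by move=> x; rewrite in_itv/= => /andP[a b]; apply: (@ex_derive _ _ _ _ _ _ _ (dG x _)); rewrite !ltW.
  + by apply: cvg_at_right_filter; apply: cG; rewrite lexx ltW.
  + by apply: cvg_at_left_filter; apply: cG; rewrite lexx ltW.
- move=> x; rewrite in_itv/= => /andP[a b]; rewrite derive1E.
  by apply: derive_val; apply: dG; rewrite !ltW.
Qed.

Definition has_cint (f : R -> C) (v : C) : Prop :=
  has_int (fun x => complex.Re (f x)) (complex.Re v) /\
  has_int (fun x => complex.Im (f x)) (complex.Im v).

Lemma has_cintE (f : R -> C) (v : C) : has_cint f v -> cintegrable f /\ cintegral f = v.
Proof.
move=> [[ri rv] [ii iv]]; split; first by split.
by rewrite /cintegral rv iv -complexE.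
Qed.

Lemma has_cint_ext (f g : R -> C) (v : C) : f =1 g -> has_cint f v -> has_cint g v.
Proof. by move=> /funext <-. Qed.

Lemma has_cintD (f g : R -> C) (u v : C) : has_cint f u -> has_cint g v ->
  has_cint (fun x => f x + g x) (u + v).
Proof.
move=> [fr fi] [gr gi]; split.
- have -> : complex.Re (u + v) = complex.Re u + complex.Re v by case: u v {fr fi gr gi} => ? ? [].
  by apply: has_int_ext (has_intD fr gr) => x; case: (f x) (g x) => ? ? [].
- have -> : complex.Im (u + v) = complex.Im u + complex.Im v by case: u v {fr fi gr gi} => ? ? [].
  by apply: has_int_ext (has_intD fi gi) => x; case: (f x) (g x) => ? ? [].
Qed.

Lemma has_cintZ (f : R -> C) (c v : C) : has_cint f v -> has_cint (fun x => c * f x) (c * v).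
Proof.
move=> [fr fi]; case: c => a b; split.
- have -> : complex.Re ((a +i* b)%C * v) = a * complex.Re v - b * complex.Im v by case: v {fr fi}.
  apply: has_int_ext (has_intB (has_intZ a fr) (has_intZ b fi)) => x.
  by case: (f x).
- have -> : complex.Im ((a +i* b)%C * v) = a * complex.Im v + b * complex.Re v by case: v {fr fi}.
  apply: has_int_ext (has_intD (has_intZ a fi) (has_intZ b fr)) => x.
  by case: (f x).
Qed.

Lemma has_cintB (f g : R -> C) (u v : C) : has_cint f u -> has_cint g v ->
  has_cint (fun x => f x - g x) (u - v).
Proof.
move=> fu gv; rewrite -[- v]mulN1r; apply: has_cint_ext (has_cintD fu (has_cintZ (-1) gv)).
by move=> x; rewrite mulN1r.
Qed.

Lemma has_cint_real (f : R -> R) v : has_int f v -> has_cint (fun x => (f x)%:C%C) v%:C%C.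
Proof. by move=> fv; split => //=; exact: has_int0. Qed.

Lemma has_cint_sum (I : Type) (r : seq I) (f : I -> R -> C) (v : I -> C) :
  (forall i, has_cint (f i) (v i)) ->
  has_cint (fun x => \sum_(i <- r) f i x) (\sum_(i <- r) v i).
Proof.
move=> fv; elim: r => [|i r IH].
  rewrite big_nil; apply: has_cint_ext (has_cint_real has_int0) => x.
  by rewrite big_nil.
rewrite big_cons; apply: has_cint_ext (has_cintD (fv i) IH) => x.
by rewrite big_cons.
Qed.

Lemma Re_le_cabs (z : C) : `|complex.Re z| <= cabs z.
Proof.
case: z => x y; rewrite /cabs /= -sqrtr_sqr ler_wsqrtr// lerDl; exact: sqr_ge0.
Qed.

Lemma Im_le_cabs (z : C) : `|complex.Im z| <= cabs z.
Proof.
case: z => x y; rewrite /cabs /= -sqrtr_sqr ler_wsqrtr// lerDr; exact: sqr_ge0.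
Qed.

Lemma cabs_le_ReIm (z : C) : cabs z <= `|complex.Re z| + `|complex.Im z|.
Proof.
case: z => x y; rewrite /cabs /= -[leRHS]ger0_norm ?addr_ge0// -sqrtr_sqr.
rewrite ler_wsqrtr// sqrrD !real_normK ?num_real// lerD2r lerDl.
by rewrite mulrn_wge0// mulr_ge0.
Qed.

Lemma has_cint_norm_le (f : R -> C) (g : R -> R) (u : C) v : (forall x, cabs (f x) <= g x) ->
  has_cint f u -> has_int g v -> cabs u <= 2 * v.
Proof.
move=> fg [fr fi] gv; apply: le_trans (cabs_le_ReIm u) _.
rewrite mulr2n mulrDl mul1r; apply: lerD.
- apply: has_int_norm_le fr gv => x; exact: le_trans (Re_le_cabs _) (fg x).
- apply: has_int_norm_le fi gv => x; exact: le_trans (Im_le_cabs _) (fg x).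
Qed.

Lemma has_cint_dominated (f : R -> C) (g : R -> R) v :
  measurable_fun setT (fun x => complex.Re (f x)) ->
  measurable_fun setT (fun x => complex.Im (f x)) ->
  (forall x, cabs (f x) <= g x) -> has_int g v -> exists u : C, has_cint f u.
Proof.
move=> mr mi fg gv.
have [a ha] : exists u, has_int (fun x => complex.Re (f x)) u.
  apply: has_int_dominated mr _ gv => x; exact: le_trans (Re_le_cabs _) (fg x).
have [b hb] : exists u, has_int (fun x => complex.Im (f x)) u.
  apply: has_int_dominated mi _ gv => x; exact: le_trans (Im_le_cabs _) (fg x).
by exists (a +i* b)%C.
Qed.

End HasIntegral.

(** * The complex logarithm *)

Section ComplexAbs.
Variable R : realType.
Local Notation C := R[i].
Implicit Types z w : C.

Lemma cabsE z : (cabs z)%:C%C = `|z|.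
Proof. by []. Qed.

Lemma cabs_real (x : R) : cabs x%:C%C = `|x|.
Proof. by rewrite /cabs /= expr0n addr0 sqrtr_sqr. Qed.

Lemma cabs0 : cabs (0 : C) = 0.
Proof. by apply/complexI; rewrite cabsE normr0. Qed.

Lemma cabs_ge0 z : 0 <= cabs z.
Proof. by rewrite -lecR cabsE normr_ge0. Qed.

Lemma cabs_gt0 z : (0 < cabs z) = (z != 0).
Proof. by rewrite -ltcR cabsE normr_gt0. Qed.

Lemma cabsD z w : cabs (z + w) <= cabs z + cabs w.
Proof. by rewrite -lecR rmorphD /= !cabsE ler_normD. Qed.

Lemma cabsB z w : cabs (z - w) <= cabs z + cabs w.
Proof. by rewrite -lecR rmorphD /= !cabsE ler_normB. Qed.

Lemma cabsM z w : cabs (z * w) = cabs z * cabs w.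
Proof. by apply/complexI; rewrite rmorphM /= !cabsE normrM. Qed.

Lemma cabsV z : cabs z^-1 = (cabs z)^-1.
Proof. by apply/complexI; rewrite fmorphV /= !cabsE normfV. Qed.

Lemma cabsC z w : cabs (z - w) = cabs (w - z).
Proof. by apply/complexI; rewrite !cabsE distrC. Qed.

Lemma cabs_sub_le z w : cabs z - cabs w <= cabs (z - w).
Proof. by rewrite -lecR rmorphB /= !cabsE lerB_dist. Qed.

Lemma sqr_cabs z : cabs z ^+ 2 = complex.Re z ^+ 2 + complex.Im z ^+ 2.
Proof. by case: z => x y; rewrite /cabs /= sqr_sqrtr// addr_ge0// sqr_ge0. Qed.

End ComplexAbs.

Section Clog.
Variable R : realType.
Local Notation C := R[i].
Implicit Types z w : C.

(* On the closed upper half plane without 0, [clog z] is [Log (- z)], with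
   imaginary part in [- pi, 0]: it is real on the negative half line. *)
Definition clog z : C :=
  (ln (cabs z) +i* (- acos (- complex.Re z / cabs z)))%C.

Lemma norm_Re_div_cabs z : -1 <= - complex.Re z / cabs z <= 1.
Proof.
have [z0|z0] := eqVneq (cabs z) 0.
  by rewrite z0 invr0 mulr0 lerN10 ler01.
have r0 : 0 < cabs z by rewrite lt_def z0 cabs_ge0.
have := Re_le_cabs z; rewrite ler_norml => /andP[a b].
by rewrite ler_pdivlMr// ler_pdivrMr// mulN1r mul1r lerN2 lerNl a b.
Qed.

Lemma norm_Im_clog z : `|complex.Im (clog z)| <= pi.
Proof.
rewrite /= normrN ger0_norm ?acos_ge0 ?norm_Re_div_cabs//.
by rewrite acos_lepi// norm_Re_div_cabs.
Qed.

Lemma clog_cos z : z != 0 -> cos (complex.Im (clog z)) = - complex.Re z / cabs z.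
Proof.
by move=> z0; rewrite /= cosN acosK// in_itv/= norm_Re_div_cabs.
Qed.

Lemma clog_sin z : z != 0 -> 0 <= complex.Im z ->
  sin (complex.Im (clog z)) = - complex.Im z / cabs z.
Proof.
move=> z0 y0; rewrite /= sinN sin_acos ?norm_Re_div_cabs// [RHS]mulNr; congr (- _).
have r0 : 0 < cabs z by rewrite cabs_gt0.
rewrite (_ : 1 - _ = (complex.Im z / cabs z) ^+ 2).
  by rewrite sqrtr_sqr ger0_norm// divr_ge0// ltW.
rewrite !exprMn sqrrN; have := sqr_cabs z.
rewrite exprVn => e; apply/(mulIf (expf_neq0 2 (lt0r_neq0 r0))).
rewrite mulrBl mul1r !divfK ?expf_neq0// ?lt0r_neq0//.
by rewrite e addrC addKr.
Qed.

(** Turns a chord back into an angle. On [0, 1] the mean value theorem gives a slope of sin at least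
    cos 1; on [1, pi / 2] sin s >= sin 1 while s <= 2. *)
Lemma le_sin : exists2 c : R, 0 < c &
  forall s, 0 <= s <= pi / 2 -> s <= c * sin s.
Proof.
have c1 := cos1_gt0 R.
have p2 : pi / 2 <= 2 :> R by exact/ltW/pihalf_lt2.
have s1 : 0 < sin 1 :> R by apply: sin2_gt0; lra.
have ph := @pihalf_ge1 R.
exists ((cos 1)^-1 + 2 / sin 1); first by rewrite addr_gt0 ?invr_gt0 ?divr_gt0.
move=> s /andP[s0 sp]; rewrite mulrDl.
have i1 : 0 < (cos 1)^-1 :> R by rewrite invr_gt0.
have i2 : 0 < 2 / sin 1 :> R by rewrite divr_gt0.
have ss : 0 <= sin s by apply: sin_ge0_pi; lra.
have [s1'|s1'] := leP s 1.
- apply: (@le_trans _ _ ((cos 1)^-1 * sin s)); last first.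
    by rewrite lerDl mulr_ge0// ltW.
  have [->|sn0] := eqVneq s 0; first by rewrite sin0 mulr0.
  have s0' : 0 < s by rewrite lt_def sn0.
  have [c] := @MVT R sin cos 0 s s0' (fun x _ => is_derive_sin x)
     (continuous_subspaceT (@continuous_sin R)).
  rewrite in_itv/= => /andP[c0 cs]; rewrite sin0 !subr0 => ->.
  rewrite mulrA ler_peMl// -ler_pdivrMl// invrK mulr1.
  by apply/ltW; rewrite ltr_cos ?in_itv/=; lra.
- apply: (@le_trans _ _ (2 / sin 1 * sin s)); last first.
    by rewrite lerDr mulr_ge0// ltW.
  apply: (le_trans sp); apply: (le_trans p2).
  rewrite -mulrA ler_peMr// mulrC ler_pdivlMr// mul1r.
  by apply/ltW; rewrite ltr_sin ?in_itv/=; lra.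
Qed.

(** The moduli are compared by ln (1 + t) <= t, the angles by the law of cosines. No branch is
    crossed, since the arguments on the closed half-plane fill an interval of length pi. *)
Lemma clog_lipschitz : exists2 c : R, 0 < c & forall z w,
  0 <= complex.Im z -> 0 <= complex.Im w -> w != 0 -> cabs w <= cabs z ->
  cabs (clog z - clog w) <= c * (cabs (z - w) / cabs w).
Proof.
have [c c0 csin] := le_sin.
exists (1 + c) => [|z w z0 w0 wn0 wz]; first by rewrite addr_gt0.
have rw : 0 < cabs w by rewrite cabs_gt0.
have rz : 0 < cabs z by exact: lt_le_trans wz.
have zn0 : z != 0 by rewrite -cabs_gt0.
apply: le_trans (cabs_le_ReIm _) _; rewrite mulrDl mul1r; apply: lerD.
  rewrite /= ger0_norm; last first.
    by rewrite subr_ge0 ler_ln.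
  rewrite -ln_div ?posrE//.
  have -> : cabs z / cabs w = 1 + (cabs z - cabs w) / cabs w.
    by rewrite mulrBl divff ?gt_eqF// addrC subrK.
  apply: le_trans (le_ln1Dx _) _.
    by apply: (@lt_le_trans _ _ 0) => //; rewrite divr_ge0 ?subr_ge0// ltW.
  by rewrite ler_pM2r ?invr_gt0// cabs_sub_le.
set d := complex.Im (clog z - clog w).
have dE : d = complex.Im (clog z) - complex.Im (clog w) by [].
have dpi : `|d| <= pi.
  rewrite dE ler_norml /=.
  have [a b] := (norm_Re_div_cabs z, norm_Re_div_cabs w).
  have := (acos_ge0 a, acos_lepi a, acos_ge0 b, acos_lepi b).
  by move=> [[[? ?] ?] ?]; lra.
have cd : cos d = 1 - sin (`|d| / 2) ^+ 2 *+ 2.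
  rewrite -cos_norm; have -> : `|d| = (`|d| / 2) *+ 2 by rewrite mulr2n; lra.
  rewrite cos_mulr2n cos2sin2 mulr2n (_ : (`|d| / 2) *+ 2 / 2 = `|d| / 2); last by rewrite mulr2n; lra.
  by lra.
(* |z - w|^2 = (|z| - |w|)^2 + 4 |z| |w| sin(d / 2)^2, and |w| <= |z|. *)
have key : (2 * cabs w * sin (`|d| / 2)) ^+ 2 <= cabs (z - w) ^+ 2.
  have -> : cabs (z - w) ^+ 2 =
      cabs z ^+ 2 + cabs w ^+ 2 - 2 * cabs z * cabs w * cos d.
    rewrite dE cosB !clog_cos// !clog_sin//.
    rewrite -!mulrA [cabs z * _]mulrC.
    rewrite (_ : cabs w * _ * cabs z = complex.Re z * complex.Re w + complex.Im z * complex.Im w); last first.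
      by field; rewrite !gt_eqF.
    rewrite !sqr_cabs; case: (z) (w) => x y [u v] /=; ring.
  rewrite cd; set t := sin _ ^+ 2; rewrite exprMn exprMn -/t.
  have t0 : 0 <= t by exact: sqr_ge0.
  have := sqr_ge0 (cabs z - cabs w).
  have h : 0 <= cabs w * (cabs z - cabs w) * t.
    by apply: mulr_ge0 => //; apply: mulr_ge0; [exact: ltW|rewrite subr_ge0].
  rewrite mulr2n; nra.
have sd : 0 <= sin (`|d| / 2).
  by apply: sin_ge0_pi; have := normr_ge0 d; have := @pi_gt0 R; lra.
move: key; rewrite ler_pXn2r// ?nnegrE ?cabs_ge0//; last first.
  by rewrite !mulr_ge0 ?ler0n// ltW.
move=> key.
have hs : `|d| / 2 <= c * sin (`|d| / 2).
  by apply: csin; have := normr_ge0 d; have := @pi_gt0 R; lra.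
rewrite mulrA ler_pdivlMr//.
apply: le_trans (_ : c * (2 * cabs w * sin (`|d| / 2)) <= _); last by rewrite ler_pM2l.
have : `|d| / 2 * (2 * cabs w) <= c * sin (`|d| / 2) * (2 * cabs w).
  by rewrite ler_wpM2r// mulr_ge0// ltW.
lra.
Qed.

End Clog.

(** * Hölder continuity of the Cauchy transforms *)

Section LocHolder.
Variables (R : realType) (al : R).
Hypothesis al01 : 0 < al < 1.
Local Notation C := R[i].
Implicit Types (E : set C) (f g : C -> C).

Lemma loc_Holder_ge0 E f : loc_Holder_on E al f -> forall r, exists2 L : R, 0 <= L &
  forall z1 z2, E z1 -> E z2 -> cabs z1 <= r -> cabs z2 <= r ->
    cabs (f z1 - f z2) <= L * powR (cabs (z1 - z2)) al.
Proof.
move=> Hf r; have [L HL] := Hf r; exists `|L| => // z1 z2 E1 E2 r1 r2.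
apply: le_trans (HL _ _ E1 E2 r1 r2) _.
by rewrite ler_wpM2r ?powR_ge0// ler_norm.
Qed.

Lemma loc_Holder_bounded E f : loc_Holder_on E al f -> forall r, exists2 M : R, 0 <= M &
  forall z, E z -> cabs z <= r -> cabs (f z) <= M.
Proof.
move=> /loc_Holder_ge0 Hf r; have [L L0 HL] := Hf r.
have [[z0 [E0 r0]]|no] := pselect (exists z0, E z0 /\ cabs z0 <= r); last first.
  by exists 0 => // z Ez rz; exfalso; apply: no; exists z.
exists (cabs (f z0) + L * powR (r + r) al).
  by rewrite addr_ge0 ?mulr_ge0 ?powR_ge0 ?cabs_ge0.
move=> z Ez rz; rewrite -[f z](subrK (f z0)) addrC.
apply: le_trans (cabsD _ _) _; rewrite lerD2l.
apply: le_trans (HL _ _ Ez E0 rz r0) _; apply: ler_wpM2l => //.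
have a0 : 0 <= al by case/andP: al01 => /ltW.
apply: ge0_ler_powR => //; rewrite ?nnegrE ?cabs_ge0//.
  by have := le_trans (cabs_ge0 z0) r0; lra.
by apply: le_trans (cabsB _ _) _; exact: lerD.
Qed.

Lemma loc_Holder_ext E f g : (forall z, E z -> f z = g z) ->
  loc_Holder_on E al f -> loc_Holder_on E al g.
Proof.
move=> fg Hf r; have [L HL] := Hf r; exists L => z1 z2 E1 E2.
by rewrite -!fg//; exact: HL.
Qed.

Lemma loc_Holder_cst E c : loc_Holder_on E al (fun=> c).
Proof. by move=> r; exists 0 => z1 z2 *; rewrite subrr cabs0 mul0r. Qed.

Lemma loc_Holder_id E : loc_Holder_on E al id.
Proof.
case/andP: al01 => a0 a1 r; exists (powR (r + r) (1 - al)) => z1 z2 _ _ r1 r2.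
have [->|d0] := eqVneq (cabs (z1 - z2)) 0.
  by rewrite mulr_ge0 ?powR_ge0.
rewrite -[leLHS]powRr1 ?cabs_ge0// -{1}(subrK al 1) powRD ?d0 ?implybT//.
rewrite ler_wpM2r ?powR_ge0//.
apply: ge0_ler_powR; rewrite ?nnegrE ?cabs_ge0 ?subr_ge0 ?(ltW a1)//.
  by have := le_trans (cabs_ge0 z1) r1; lra.
by apply: le_trans (cabsB _ _) _; exact: lerD.
Qed.

Lemma loc_HolderD E f g : loc_Holder_on E al f -> loc_Holder_on E al g ->
  loc_Holder_on E al (fun z => f z + g z).
Proof.
move=> Hf Hg r; have [L HL] := Hf r; have [M HM] := Hg r.
exists (L + M) => z1 z2 E1 E2 r1 r2; rewrite opprD addrACA mulrDl.
by apply: le_trans (cabsD _ _) _; apply: lerD; [exact: HL|exact: HM].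
Qed.

Lemma loc_HolderM E f g : loc_Holder_on E al f -> loc_Holder_on E al g ->
  loc_Holder_on E al (fun z => f z * g z).
Proof.
move=> Hf Hg r.
have [L L0 HL] := loc_Holder_ge0 Hf r; have [M M0 HM] := loc_Holder_ge0 Hg r.
have [Bf Bf0 HBf] := loc_Holder_bounded Hf r.
have [Bg Bg0 HBg] := loc_Holder_bounded Hg r.
exists (Bf * M + Bg * L) => z1 z2 E1 E2 r1 r2.
have -> : f z1 * g z1 - f z2 * g z2 = f z1 * (g z1 - g z2) + g z2 * (f z1 - f z2) by ring.
apply: le_trans (cabsD _ _) _; rewrite !cabsM mulrDl -!mulrA.
by apply: lerD; apply: ler_pM; rewrite ?cabs_ge0//; auto.
Qed.

Lemma loc_HolderZ E c f : loc_Holder_on E al f -> loc_Holder_on E al (fun z => c * f z).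
Proof. by apply: loc_HolderM; exact: loc_Holder_cst. Qed.

Lemma loc_HolderB E f g : loc_Holder_on E al f -> loc_Holder_on E al g ->
  loc_Holder_on E al (fun z => f z - g z).
Proof.
move=> Hf /(loc_HolderZ (-1)) /(loc_HolderD Hf); apply: loc_Holder_ext => z _.
by rewrite mulN1r.
Qed.

Lemma loc_Holder_sum E (I : Type) (s : seq I) (f : I -> C -> C) :
  (forall i, loc_Holder_on E al (f i)) ->
  loc_Holder_on E al (fun z => \sum_(i <- s) f i z).
Proof.
move=> Hf; elim: s => [|i s IH].
  by apply: loc_Holder_ext (loc_Holder_cst E 0) => z _; rewrite big_nil.
by apply: loc_Holder_ext (loc_HolderD (Hf i) IH) => z _; rewrite big_cons.
Qed.

Lemma loc_Holder_affine E E' f (a b : C) : (forall z, E' z -> E (a * z + b)) ->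
  loc_Holder_on E al f -> loc_Holder_on E' al (fun z => f (a * z + b)).
Proof.
move=> EE' Hf r; have [L L0 HL] := loc_Holder_ge0 Hf (cabs a * r + cabs b).
exists (L * powR (cabs a) al) => z1 z2 E1 E2 r1 r2.
have bnd z : cabs z <= r -> cabs (a * z + b) <= cabs a * r + cabs b.
  move=> rz; apply: le_trans (cabsD _ _) _; rewrite cabsM lerD2r.
  by rewrite ler_wpM2l ?cabs_ge0.
apply: le_trans (HL _ _ (EE' _ E1) (EE' _ E2) (bnd _ r1) (bnd _ r2)) _.
have -> : a * z1 + b - (a * z2 + b) = a * (z1 - z2) by ring.
by rewrite cabsM powRM ?cabs_ge0// mulrA.
Qed.

End LocHolder.

(** * Cardinal Cauchy transforms: boundary regularity and boundary values *)

Section CardinalCauchy.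
Variable R : realType.
Local Notation C := R[i].

Definition UHPc : set C := [set z | 0 <= complex.Im z].

Definition zlog (z : C) : C := z * clog z.

(** If ln t >= 0, use ln t <= t <= |r|; otherwise ln u <= u at u = t^(-s) gives t^s |ln t| <= 1 /
    s. *)
Lemma powR_ln_bounded (s r : R) : 0 < s -> exists2 M : R, 0 <= M &
  forall t, 0 < t <= r -> powR t s * `|ln t| <= M.
Proof.
move=> s0; exists (s^-1 + powR `|r| s * `|r|).
  by rewrite addr_ge0 ?invr_ge0 ?(ltW s0)// mulr_ge0 ?powR_ge0.
move=> t /andP[t0 tr]; have ts0 : 0 < powR t s by exact: powR_gt0.
have tr' : t <= `|r| by apply: le_trans tr _; exact: ler_norm.
have [l0|l0] := leP 0 (ln t).
- rewrite ger0_norm//; apply: (@le_trans _ _ (powR `|r| s * `|r|)); last first.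
    by rewrite lerDr invr_ge0 ltW.
  apply: ler_pM => //; first exact: ltW.
    by apply: ge0_ler_powR; rewrite ?nnegrE ?(ltW s0) ?(ltW t0).
  apply: le_trans tr'; have := @le_ln1Dx R (t - 1).
  rewrite (_ : 1 + (t - 1) = t); last by ring.
  have t1 : -1 < t - 1 by lra.
  by move=> /(_ t1) h; lra.
- rewrite ltr0_norm//; apply: (@le_trans _ _ s^-1); last first.
    by rewrite lerDl mulr_ge0 ?powR_ge0.
  have h : ln (powR t (- s)) <= powR t (- s).
    have p0 := powR_gt0 (- s) t0.
    have t1 : -1 < powR t (- s) - 1 by lra.
    have := le_ln1Dx t1; rewrite (_ : 1 + (_ - 1) = powR t (- s)); last by ring.
    by lra.
  move: h.
  rewrite ln_powR mulNr -mulrN powRN => h.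
  rewrite -(ler_pM2l s0) divff ?gt_eqF// mulrCA.
  by rewrite -(@divff _ (powR t s)) ?gt_eqF// ler_pM2l.
Qed.

(** With |z2| <= |z1|, split the difference as (z1 - z2) log z1 + z2 (log z1 - log z2). The factor
    z2 cancels the denominator in [clog_lipschitz], and |z1 - z2| <= 2 |z1| provides a power |z1|^(1
    - al) that absorbs log z1. *)
Lemma zlog_loc_Holder (al : R) : 0 < al < 1 -> loc_Holder_on UHPc al zlog.
Proof.
move=> /andP[a0 a1] r.
have [c c0 hc] := @clog_lipschitz R.
have s0 : 0 < 1 - al by rewrite subr_gt0.
have [M M0 hM] := powR_ln_bounded r s0.
pose D := powR 2 (1 - al) * (M + powR `|r| (1 - al) * (pi + c)).
have main z1 z2 : UHPc z1 -> UHPc z2 -> cabs z1 <= r -> cabs z2 <= cabs z1 ->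
    cabs (zlog z1 - zlog z2) <= D * powR (cabs (z1 - z2)) al.
  move=> H1 H2 r1 r21.
  have pi0 := @pi_gt0 R.
  have D0 : 0 <= D.
    by rewrite mulr_ge0 ?powR_ge0// addr_ge0// mulr_ge0 ?powR_ge0//; lra.
  have [z10|z10] := eqVneq z1 0.
    move: r21; rewrite z10 cabs0 => r21.
    have [/eqP|z20] := boolP (z2 == 0); last by move: r21; rewrite leNgt cabs_gt0 z20.
    by move=> ->; rewrite subrr cabs0 mulr_ge0 ?powR_ge0.
  have r10 : 0 < cabs z1 by rewrite cabs_gt0.
  set d := cabs (z1 - z2).
  have d2 : d <= 2 * cabs z1 by apply: le_trans (cabsB _ _) _; lra.
  have step : cabs (zlog z1 - zlog z2) <= d * (cabs (clog z1) + c).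
    have -> : zlog z1 - zlog z2 = (z1 - z2) * clog z1 + z2 * (clog z1 - clog z2) by rewrite /zlog; ring.
    apply: le_trans (cabsD _ _) _; rewrite !cabsM mulrDr lerD2l.
    have [->|z20] := eqVneq z2 0; first by rewrite cabs0 mul0r mulr_ge0 ?cabs_ge0// ltW.
    have r20 : 0 < cabs z2 by rewrite cabs_gt0.
    apply: le_trans (ler_wpM2l (ltW r20) (hc _ _ H1 H2 z20 r21)) _.
    have e : cabs z2 * (c * (d / cabs z2)) = d * c by field; rewrite gt_eqF.
    by rewrite -/d e.
  apply: le_trans step _.
  have [->|d0] := eqVneq d 0; first by rewrite mul0r mulr_ge0 ?powR_ge0.
  have dge0 : 0 <= d by exact: cabs_ge0.
  rewrite [X in X * _](_ : d = powR d (1 - al) * powR d al); last first.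
    by rewrite -powRD ?d0 ?implybT// subrK powRr1.
  rewrite mulrAC ler_wpM2r ?powR_ge0//.
  have dp : powR d (1 - al) <= powR 2 (1 - al) * powR (cabs z1) (1 - al).
    rewrite -powRM ?cabs_ge0//; apply: ge0_ler_powR; rewrite ?nnegrE ?(ltW s0)//.
    by rewrite mulr_ge0 ?cabs_ge0.
  have lb : cabs (clog z1) <= `|ln (cabs z1)| + pi.
    by apply: le_trans (cabs_le_ReIm _) _; rewrite lerD2l norm_Im_clog.
  apply: le_trans (_ : powR 2 (1 - al) * powR (cabs z1) (1 - al) * (`|ln (cabs z1)| + pi + c) <= _).
    by apply: ler_pM; rewrite ?powR_ge0 ?addr_ge0 ?cabs_ge0 ?lerD2r// ltW.
  rewrite /D -mulrA ler_wpM2l ?powR_ge0// -addrA mulrDr lerD//.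
    by apply: hM; rewrite r10.
  rewrite ler_wpM2r//; first by rewrite addr_ge0// ltW.
  apply: ge0_ler_powR; rewrite ?nnegrE ?(ltW s0) ?cabs_ge0//.
  by apply: le_trans r1 _; exact: ler_norm.
exists D => z1 z2 H1 H2 r1 r2; have [h|/ltW h] := leP (cabs z2) (cabs z1).
  exact: main.
by rewrite cabsC [cabs (z1 - z2)]cabsC; exact: main.
Qed.

(* The Cauchy transform of [cardB j], off its support: the Cox--de Boor
   recursion is inherited because the masses of consecutive B-splines cancel. *)
Fixpoint cardK (j : nat) (z : C) : C :=
  match j with
  | 0%N => 0
  | 1%N => clog (z - 1) - clog z
  | j'.+1 => (z * cardK j' z + (j'.+1%:R - z) * cardK j' (z - 1)) / j'%:R
  end.

Lemma cardKS j z : (0 < j)%N ->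
  cardK j.+1 z = (z * cardK j z + (j.+1%:R - z) * cardK j (z - 1)) / j%:R.
Proof. by case: j. Qed.

Lemma cardBS j (x : R) : (0 < j)%N ->
  cardB j.+1 x = (x * cardB j x + (j.+1%:R - x) * cardB j (x - 1)) / j%:R.
Proof. by case: j. Qed.

(** A second difference of z log z: each logarithm now carries a factor vanishing at its own
    singularity, which fails at order one. *)
Lemma cardK2 z : cardK 2 z = 2 * zlog (z - 1) - zlog z - zlog (z - 2).
Proof.
rewrite cardKS// /zlog /= divr1 (_ : z - 1 - 1 = z - 2); last by ring.
by ring.
Qed.

Lemma UHPc_subr z (x : R) : UHPc z -> UHPc (z - x%:C%C).
Proof. by case: z => a b; rewrite /UHPc /= oppr0 addr0. Qed.

Lemma cardK_loc_Holder (al : R) m : 0 < al < 1 -> (2 <= m)%N ->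
  loc_Holder_on UHPc al (cardK m).
Proof.
move=> al01; elim: m => // m IH; rewrite ltnS leq_eqVlt => /predU1P[<-|m2].
  have Hz := zlog_loc_Holder al01.
  have sh (x : R) : loc_Holder_on UHPc al (fun z => zlog (1 * z + - x%:C%C)).
    apply: loc_Holder_affine Hz => // z hz; rewrite mul1r; exact: UHPc_subr.
  have := loc_HolderB al01 (loc_HolderB al01 (loc_HolderZ al01 2 (sh 1)) Hz) (sh 2).
  by apply: loc_Holder_ext => z _; rewrite cardK2 !mul1r rmorph1 rmorph_nat.
have {IH m2} [IH m0] := (IH m2, ltnW m2).
have sh : loc_Holder_on UHPc al (fun z => cardK m (1 * z + - 1%:C%C)).
  apply: loc_Holder_affine IH => // z hz; rewrite mul1r; exact: UHPc_subr.
have Hid := loc_Holder_id al01 UHPc.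
have := loc_HolderZ al01 m%:R^-1 (loc_HolderD (loc_HolderM al01 Hid IH)
  (loc_HolderM al01 (loc_HolderB al01 (loc_Holder_cst al _ m.+1%:R) Hid) sh)).
by apply: loc_Holder_ext => z _; rewrite cardKS// mul1r rmorph1 [RHS]mulrC.
Qed.

(** Up to the factor - pi, a truncated power, whose second difference is the hat function
    [cardB 2]. *)
Lemma Im_zlog_real (x : R) : complex.Im (zlog x%:C%C) = - pi * Num.max x 0.
Proof.
rewrite /zlog /clog cabs_real /= mul0r addr0.
have [x0|x0|->] := ltrgt0P x.
- by rewrite mulNr divff ?gt_eqF// acosN1 mulrN mulNr mulrC.
- by rewrite invrN mulrNN divff ?lt_eqF// acos1 oppr0 !mulr0.
- by rewrite mul0r mulr0.
Qed.

Lemma Im_realM (x : R) (z : C) : complex.Im (x%:C%C * z) = x * complex.Im z.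
Proof. by case: z => a b; rewrite /= mul0r addr0. Qed.

(** The Sokhotski-Plemelj relation obtained without a limit: on the real line [cardK] and [cardB]
    obey the same recursion with real coefficients, so it is enough to compare them at order 2. *)
Lemma Im_cardK_real m (x : R) : (2 <= m)%N ->
  complex.Im (cardK m x%:C%C) = pi * cardB m x.
Proof.
elim: m x => // m IH x; rewrite ltnS leq_eqVlt => /predU1P[<-|m2].
  rewrite cardK2 -[2 : C](rmorph_nat (real_complex R)) -[1 : C](rmorph1 (real_complex R)) -!rmorphB.
  have ImB (u v : C) : complex.Im (u - v) = complex.Im u - complex.Im v by case: u v => ? ? [].
  rewrite !ImB Im_realM !Im_zlog_real cardBS//= divr1.
  rewrite !(fun_if (fun t : R => _ * t)) !mulr1 !mulr0.
  rewrite /Num.max; case: ltP => h1; case: ltP => h2; case: ltP => h3; case: (leP 0 x) => h4;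
   case: (leP 0 (x - 1)) => h5; case: (ltP x 1) => h6; case: (ltP (x - 1) 1) => h7 /=; lra.
have [m0 mR] : (0 < m)%N /\ m%:R != 0 :> R by split; [exact: ltnW|rewrite pnatr_eq0 -lt0n ltnW].
rewrite cardKS// cardBS// mulrC -[m%:R : C](rmorph_nat (real_complex R)) -fmorphV Im_realM.
have -> : (m.+1%:R - x%:C%C : C) = (m.+1%:R - x)%:C%C by rewrite rmorphB /= rmorph_nat.
have -> : (x%:C%C - 1 : C) = (x - 1)%:C%C by rewrite rmorphB /= rmorph1.
have ImD (u v : C) : complex.Im (u + v) = complex.Im u + complex.Im v by case: u v => ? ? [].
rewrite ImD !Im_realM !IH//; by field.
Qed.

End CardinalCauchy.

(** * Cauchy integrals of B-splines *)

Section CauchyIntegral.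
Variable R : realType.
Local Notation C := R[i].

Lemma cardB_out j (u : R) : ~~ ((0 <= u) && (u < j%:R)) -> cardB j u = 0.
Proof.
elim: j u => // j IH u; case: (posnP j) => [->|j0].
  by rewrite /= => /negbTE ->.
rewrite cardBS// => h.
rewrite IH; last first.
  by apply: contra h => /andP[-> /= h]; rewrite (lt_trans h)// ltr_nat.
rewrite IH; first by rewrite !mulr0 addr0 mul0r.
apply: contra h => /andP[h1 h2]; rewrite -natr1; apply/andP; split; lra.
Qed.

Lemma cardB_ge0 j (u : R) : 0 <= cardB j u.
Proof.
elim: j u => // j IH u; case: (posnP j) => [->|j0].
  by rewrite /=; case: ifP.
rewrite cardBS// divr_ge0// addr_ge0//.
- have [u0|u0] := leP 0 u; first by rewrite mulr_ge0.
  by rewrite cardB_out ?mulr0// negb_and -ltNge u0.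
- have [u0|u0] := leP u j.+1%:R; first by rewrite mulr_ge0// subr_ge0.
  rewrite cardB_out ?mulr0// negb_and -leNgt; move: u0; rewrite -natr1 => u0.
  by apply/orP; right; lra.
Qed.

(** The bounds on [u] keep every translate whose support contains [u] within the range of
    summation. *)
Lemma cardB_partition j n (u : R) : (0 < j)%N -> j%:R - 1 <= u -> u < n%:R ->
  \sum_(k < n) cardB j (u - k%:R) = 1.
Proof.
move=> + + un; elim: j => // j IH _; case: (posnP j) => [->|j0] hu.
  rewrite subrr in hu; set i := Num.truncn u.
  have /andP[i1 i2] : i%:R <= u < i.+1%:R by exact: truncn_itv.
  have ilt : (i < n)%N by rewrite -(ltr_nat R); exact: le_lt_trans un.
  rewrite (bigD1 (Ordinal ilt))//= big1 => [|k /eqP ki].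
    by rewrite addr0 subr_ge0 i1 ltrBlDr nat1r i2.
  case: ifP => // /andP[]; rewrite subr_ge0 ltrBlDr nat1r => h1 h2.
  case: ki; apply/val_inj => /=; apply/eqP; rewrite eqn_leq.
  by rewrite -ltnS -(ltr_nat R) (le_lt_trans h1)//= -ltnS -(ltr_nat R) (le_lt_trans i1).
have hu' : j%:R <= u by rewrite -natr1 addrK in hu.
have jR : j%:R != 0 :> R by rewrite pnatr_eq0 -lt0n.
under eq_bigr do rewrite cardBS//.
rewrite -mulr_suml big_split /=.
(* Shift the index by one; the terms at both ends vanish because u >= j and u < n. The two linear
   weights on [cardB j] then add up to j. *)
have -> : \sum_(k < n) (j.+1%:R - (u - k%:R)) * cardB j (u - k%:R - 1) =
          \sum_(k < n) (j%:R - (u - k%:R)) * cardB j (u - k%:R).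
  pose f (k : nat) := (j%:R - (u - k%:R)) * cardB j (u - k%:R).
  have fS (k : 'I_n) : (j.+1%:R - (u - k%:R)) * cardB j (u - k%:R - 1) = f k.+1.
    rewrite /f (_ : u - k.+1%:R = u - k%:R - 1); last by rewrite -natr1; ring.
    by congr (_ * _); rewrite -natr1; ring.
  rewrite (eq_bigr (fun k : 'I_n => f k.+1))//.
  have := big_ord_recl n (fun k => f k) (op := +%R) (idx := 0).
  rewrite big_ord_recr /= /f subr0 [cardB j u]cardB_out ?[cardB j (u - n%:R)]cardB_out.
  - by rewrite !mulr0 addr0 add0r => ->; apply: eq_bigr => k _; rewrite /bump.
  - by rewrite negb_and -ltNge subr_lt0 un.
  - by rewrite negb_and -leNgt hu' orbT.
rewrite -big_split /=.
rewrite (eq_bigr (fun k : 'I_n => j%:R * cardB j (u - k%:R))); last by move=> k _; ring.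
rewrite -mulr_sumr IH//; last by lra.
by rewrite mulr1 divff.
Qed.

Lemma is_derive_pow n (s : R) :
  is_derive s 1 (fun x : R => x ^+ n) (n%:R * s ^+ n.-1).
Proof.
rewrite (_ : (fun x => x ^+ n) = (@idfun R) ^+ n); last first.
  by apply/funext => u; rewrite exprfctE.
case: n => [|n]; first by rewrite mul0r expr0; exact: is_derive_cst.
by apply: is_derive_eq; rewrite /= /GRing.scale /= mulr1.
Qed.

Lemma has_int_is_derive (A B : R) (f G : R -> R) : A < B ->
  (forall x, A <= x <= B -> is_derive x 1 G (f x)) ->
  (forall x, A <= x <= B -> exists df : R, is_derive x 1 f df) ->
  has_int (fun x => if (A <= x) && (x < B) then f x else 0) (G B - G A).
Proof.
move=> AB dG df; apply: has_int_cell => // x /df [d [dx _]].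
exact/differentiable_continuous/derivable1_diffP.
Qed.

Variables (t0 h : R).
Hypothesis h0 : 0 < h.

Let knot (k : nat) : R := t0 + k%:R * h.
Let loc (k : nat) (xi : R) : R := (xi - t0) / h - k%:R.

Lemma loc_cell k xi : (0 <= loc k xi) && (loc k xi < 1) = (knot k <= xi) && (xi < knot k + h).
Proof.
rewrite /loc /knot subr_ge0 ltrBlDr ler_pdivlMr// ltr_pdivrMr// mulrDl mul1r.
by congr (_ && _); apply/idP/idP; lra.
Qed.

Lemma locS k xi : loc k.+1 xi = loc k xi - 1.
Proof. by rewrite /loc -natr1 opprD addrA. Qed.

Lemma is_derive_loc k (xi : R) : is_derive xi 1 (loc k) h^-1.
Proof. by rewrite /loc; apply: is_derive_eq; rewrite /GRing.scale /=; ring. Qed.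

Lemma cell_moment i k :
  has_int (fun xi => loc k xi ^+ i * cardB 1 (loc k xi)) (h / i.+1%:R).
Proof.
have hn : h != 0 by rewrite gt_eqF.
have := @has_int_is_derive (knot k) (knot k + h) (fun xi => loc k xi ^+ i)
  (fun xi => h / i.+1%:R * loc k xi ^+ i.+1).
have lk : loc k (knot k) = 0 by rewrite /loc /knot; field.
have lk1 : loc k (knot k + h) = 1 by rewrite /loc /knot; field.
rewrite ltrDl h0 lk lk1 expr1n expr0n mulr0 subr0 mulr1.
have dX n (xi : R) : is_derive xi 1 (fun xi => loc k xi ^+ n) (n%:R * loc k xi ^+ n.-1 * h^-1).
  exact: (@is_derive1_comp R (fun x => x ^+ n) (loc k) xi _ _ (is_derive_pow n (loc k xi)) (is_derive_loc k xi)).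
move=> /(_ isT) H; apply: has_int_ext (H _ _) => [xi|xi _|xi _].
- by rewrite /= loc_cell; case: ifP => _; rewrite ?mulr1 ?mulr0.
- have := dX i.+1 xi => D; apply: is_derive_eq; rewrite /GRing.scale /=; field.
  by rewrite hn addrC natr1 pnatr_eq0.
- by exists (i%:R * loc k xi ^+ i.-1 * h^-1); exact: dX.
Qed.

(** Cox--de Boor multiplies by linear factors, so the induction runs over all polynomial weights.
    The value is quantified before [k]: invariance under grid translation is what lets masses cancel
    in [cauchy_spline]. *)
Lemma spline_moment j (P : {poly R}) : (0 < j)%N -> exists v : R, forall k : nat,
  has_int (fun xi => P.[loc k xi] * cardB j (loc k xi)) v.
Proof.
elim: j P => // j IH P _; case: (posnP j) => [->|j0].
  exists (\sum_(i < size P) P`_i * (h / i.+1%:R)) => k.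
  have S := has_int_sum (index_enum 'I_(size P)) (fun i : 'I_(size P) =>
    has_intZ P`_i (cell_moment i k)).
  apply: has_int_ext S => xi.
  rewrite horner_coef mulr_suml; apply: eq_bigr => i _; by rewrite mulrA.
have [v1 H1] := IH (P * 'X) j0.
(* Written in the coordinate of the next cell: loc k = loc k.+1 + 1, hence j + 1 - loc k = j - loc
   k.+1. *)
have [v2 H2] := IH ((P \Po ('X + 1%:P)) * (j%:R%:P - 'X)) j0.
exists (j%:R^-1 * (v1 + v2)) => k.
apply: has_int_ext (has_intZ j%:R^-1 (has_intD (H1 k) (H2 k.+1))) => xi.
rewrite cardBS// locS !hornerE /= !horner_comp !hornerE /= subrK -natr1.
by ring.
Qed.

(** Positivity: between the knots j - 1 and j the first j translates sum to one, so j equal masses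
    together are at least h. *)
Lemma spline_mass j : (0 < j)%N -> exists2 v : R, 0 < v & forall k,
  has_int (fun xi => cardB j (loc k xi)) v.
Proof.
move=> j0; have [v Hv] := spline_moment 1%:P j0.
have Hv' k : has_int (fun xi => cardB j (loc k xi)) v.
  by apply: has_int_ext (Hv k) => xi; rewrite hornerC mul1r.
exists v => //.
have S := has_int_sum (index_enum 'I_j) (fun k : 'I_j => Hv' k).
have := cell_moment 0 j.-1; rewrite divr1 => H.
have : h <= \sum_(i < j) v.
  apply: has_int_le H S => xi; rewrite expr0 mul1r /=.
  case: ifPn => [/andP[l0 l1]|_]; last by apply: sumr_ge0 => i _; exact: cardB_ge0.
  have j1 : j.-1%:R = j%:R - 1 :> R by rewrite -{2}(prednK j0) -natr1 addrK.
  rewrite [leRHS](_ : _ = \sum_(i < j) cardB j ((xi - t0) / h - i%:R))//.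
  by rewrite cardB_partition//; move: l0 l1; rewrite /loc j1; lra.
rewrite sumr_const card_ord => hv.
have : 0 < v *+ j by exact: lt_le_trans hv.
by rewrite pmulrn_lgt0.
Qed.

Lemma natrC k : (k%:R : R)%:C%C = k%:R :> C.
Proof. by rewrite rmorph_nat. Qed.

(** Points for which 1 / (xi - z) is regular on [A, +oo[. Admitting real points left of A makes one
    formula serve both the half-plane and the boundary values of far splines. *)
Definition below (A : R) (z : C) :=
  0 < complex.Im z \/ (complex.Im z = 0 /\ complex.Re z < A).

Lemma clog_realM (z : C) : z != 0 -> clog (h%:C%C * z) = (ln h)%:C%C + clog z.
Proof.
move=> z0; have r0 : 0 < cabs z by rewrite cabs_gt0.
rewrite /clog cabsM cabs_real gtr0_norm// lnM ?posrE//.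
have -> : complex.Re (h%:C%C * z) = h * complex.Re z by case: (z) => x y; rewrite /= mul0r subr0.
rewrite -mulrN -mulf_div divff ?gt_eqF// mul1r.
by apply/eqP; rewrite eq_complex /= add0r !eqxx.
Qed.

Lemma invc_sub (xi : R) (z : C) : (xi%:C%C - z)^-1 =
  ((xi - complex.Re z) / ((xi - complex.Re z) ^+ 2 + complex.Im z ^+ 2) +i*
   (complex.Im z / ((xi - complex.Re z) ^+ 2 + complex.Im z ^+ 2)))%C.
Proof.
case: z => x y; apply/eqP; rewrite eq_complex /= sub0r sqrrN.
by rewrite -mulNr opprK !eqxx.
Qed.

Lemma clog_cell (A B : R) (z : C) : A < B -> below A z ->
  has_cint (fun xi => if (A <= xi) && (xi < B) then (xi%:C%C - z)^-1 else 0)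
    (clog (z - B%:C%C) - clog (z - A%:C%C)).
Proof.
move=> AB; case: z => x y bz.
have q0 s : A <= s <= B -> 0 < (s - x) ^+ 2 + y ^+ 2.
  move=> /andP[As _]; case: bz => /= [y0|[-> xA]].
    by rewrite ltr_wpDl ?sqr_ge0// exprn_gt0.
  by rewrite expr0n addr0 exprn_gt0// subr_gt0; lra.
have dq (s : R) : is_derive s 1 (fun s : R => (s - x) ^+ 2 + y ^+ 2) (2 * (s - x)).
  by apply: is_derive_eq; rewrite /GRing.scale /=; ring.
have dV (s : R) : A <= s <= B -> is_derive s 1 (fun s : R => ((s - x) ^+ 2 + y ^+ 2)^-1)
    (- ((s - x) ^+ 2 + y ^+ 2) ^- 2 *: (2 * (s - x))).
  by move=> hs; apply: is_deriveV; rewrite gt_eqF ?q0.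
split => /=.
- have rlog s : ln (cabs ((x +i* y)%C - s%:C%C)) = 2^-1 * ln ((s - x) ^+ 2 + y ^+ 2).
    rewrite /cabs /= oppr0 addr0 -[X in X + _]sqrrN opprB.
    have [q|q] := ltP 0 ((s - x) ^+ 2 + y ^+ 2).
      rewrite -[in RHS](sqr_sqrtr (ltW q)) lnXn ?sqrtr_gt0//.
      by field.
    by rewrite [in LHS]ler0_sqrtr// !ln0// ?mulr0.
  rewrite !rlog.
  apply: has_int_ext (has_int_is_derive (f := fun xi => (xi - x) / ((xi - x) ^+ 2 + y ^+ 2))
    (G := fun xi => 2^-1 * ln ((xi - x) ^+ 2 + y ^+ 2)) AB _ _) => [xi|s hs|s hs].
  + by case: ifP => // _; rewrite invc_sub.
  + have H2 := @is_derive1_comp R (@ln R) (fun s => (s - x) ^+ 2 + y ^+ 2) s _ _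
      (is_derive1_ln (q0 s hs)) (dq s).
    by apply: is_derive_eq; rewrite /GRing.scale /=; field; rewrite gt_eqF ?q0.
  + have H := dV s hs; eexists; apply: is_derive_eq; reflexivity.
- have [y0|[yz xA]] : 0 < y \/ y = 0 /\ x < A by case: bz => /=; auto.
  (* The angle becomes an arctangent, which is differentiable on the whole line because y > 0. *)
  + have alog s : - acos (- complex.Re ((x +i* y)%C - s%:C%C) / cabs ((x +i* y)%C - s%:C%C)) =
        atan ((s - x) / y) - pi / 2.
      suff -> : acos (- complex.Re ((x +i* y)%C - s%:C%C) / cabs ((x +i* y)%C - s%:C%C)) =
        pi / 2 - atan ((s - x) / y) by ring.
      have qq : 0 < (s - x) ^+ 2 + y ^+ 2 by rewrite ltr_wpDl ?sqr_ge0// exprn_gt0.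
      rewrite -[RHS]cosK; last first.
        have := atan_gtNpi2 ((s - x) / y); have := atan_ltpi2 ((s - x) / y).
        by rewrite in_itv /=; lra.
      congr acos; rewrite -[pi / 2 - _]opprB cosN cosBpihalf.
      have ct : cos (atan ((s - x) / y)) != 0.
        by rewrite gt_eqF// cos_gt0_pihalf// atan_gtNpi2 atan_ltpi2.
      rewrite -[sin _](divfK ct) -[sin _ / _]/(tan _) atanK cos_atan.
      have -> : Num.sqrt (1 + ((s - x) / y) ^+ 2) = cabs ((x +i* y)%C - s%:C%C) / y.
        rewrite -[RHS]ger0_norm ?divr_ge0 ?cabs_ge0 ?(ltW y0)// -sqrtr_sqr [in RHS]exprMn sqr_cabs /=.
        by congr Num.sqrt; field; rewrite gt_eqF.
      have : cabs ((x +i* y)%C - s%:C%C) != 0.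
        rewrite -sqrf_eq0 sqr_cabs /= gt_eqF//.
        by rewrite oppr0 addr0 -sqrrN opprB.
      by move=> cn0 /=; field; rewrite cn0 gt_eqF.
    have da (s : R) : is_derive s 1 (fun s : R => atan ((s - x) / y)) (y / ((s - x) ^+ 2 + y ^+ 2)).
      have H : is_derive s 1 (fun s : R => (s - x) / y) y^-1.
        by apply: is_derive_eq; rewrite /GRing.scale /=; ring.
      have H2 := @is_derive1_comp R (@atan R) (fun s => (s - x) / y) s _ _
        (is_derive1_atan ((s - x) / y)) H.
      apply: is_derive_eq; field.
      by rewrite !gt_eqF// ltr_wpDl ?sqr_ge0// exprn_gt0.
    have vE : - acos (- complex.Re ((x +i* y)%C - B%:C%C) / cabs ((x +i* y)%C - B%:C%C)) -
      - acos (- complex.Re ((x +i* y)%C - A%:C%C) / cabs ((x +i* y)%C - A%:C%C)) =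
      atan ((B - x) / y) - atan ((A - x) / y) by rewrite !alog; ring.
    move: vE; rewrite /= => ->.
    apply: has_int_ext (has_int_is_derive (f := fun xi => y / ((xi - x) ^+ 2 + y ^+ 2))
      (G := fun xi => atan ((xi - x) / y)) AB (fun s _ => da s) _) => [xi|s hs].
    * by case: ifP => // _; rewrite invc_sub.
    * have H := dV s hs; eexists; apply: is_derive_eq; reflexivity.
  + have xB : x < B by lra.
    have rl s : x < s -> - acos (- complex.Re ((x +i* y)%C - s%:C%C) / cabs ((x +i* y)%C - s%:C%C)) = 0.
      move=> xs; rewrite yz (_ : (x +i* 0)%C - s%:C%C = (x - s)%:C%C); last first.
        by rewrite rmorphB.
      rewrite cabs_real /= ltr0_norm ?subr_lt0// divff ?acos1 ?oppr0//.
      by rewrite oppr_eq0 lt_eqF// subr_lt0.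
    move: (rl _ xB) (rl _ xA); rewrite /= => -> ->; rewrite subrr.
    apply: has_int_ext (@has_int0 R) => xi; case: ifP => // _.
    by rewrite invc_sub /= yz mul0r.
Qed.

Lemma cauchy_spline j k (z : C) : (0 < j)%N -> below (knot k) z ->
  has_cint (fun xi => (xi%:C%C - z)^-1 * (cardB j (loc k xi))%:C%C)
    (cardK j ((z - t0%:C%C) / h%:C%C - k%:R)).
Proof.
have hC : h%:C%C != 0 :> C by rewrite (inj_eq (@complexI R)) gt_eqF.
elim: j k => // j IH k _ bz; case: (posnP j) => [->|j0].
  have Ah : knot k < knot k + h by rewrite ltrDl.
  set zeta := (z - t0%:C%C) / h%:C%C - k%:R.
  have zA : z - (knot k)%:C%C = h%:C%C * zeta.
    by rewrite /zeta /knot rmorphD rmorphM /= natrC; field.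
  have zB : z - (knot k + h)%:C%C = h%:C%C * (zeta - 1).
    by rewrite rmorphD /= opprD addrA zA; ring.
  have n0 (s : R) : knot k <= s -> z - s%:C%C != 0.
    move=> As; apply/eqP => /eqP; rewrite subr_eq0 => /eqP e.
    by case: bz; rewrite e /= ?ltxx// => -[_ /(le_lt_trans As)]; rewrite ltxx.
  have zn : zeta != 0 by have := n0 _ (lexx _); rewrite zA mulf_eq0 negb_or => /andP[].
  have zn1 : zeta - 1 != 0.
    by have := n0 _ (ltW Ah); rewrite zB mulf_eq0 negb_or => /andP[].
  have := clog_cell Ah bz; rewrite zA zB !clog_realM//.
  rewrite (_ : _ + _ - (_ + _) = cardK 1 zeta); last by rewrite /=; ring.
  apply: has_cint_ext => xi; rewrite /= loc_cell; case: ifP => _.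
    by rewrite rmorph1 mulr1.
  by rewrite rmorph0 mulr0.
have bz1 : below (knot k.+1) z.
  case: bz => [?|[? zk]]; [by left|right; split => //].
  by apply: lt_trans zk _; rewrite /knot ltrD2l ltr_pM2r// ltr_nat.
have [v _ Hv] := spline_mass j0.
set zeta := (z - t0%:C%C) / h%:C%C - k%:R.
have H1 := IH k j0 bz; have H2 := IH k.+1 j0 bz1.
have z1 : (z - t0%:C%C) / h%:C%C - k.+1%:R = zeta - 1 by rewrite /zeta -natr1; ring.
rewrite -/zeta in H1; rewrite z1 in H2.
have I1 := has_cintD (has_cintZ zeta H1) (has_cintZ h%:C%C^-1 (has_cint_real (Hv k))).
have I2 := has_cintB (has_cintZ (j.+1%:R - zeta) H2) (has_cintZ h%:C%C^-1 (has_cint_real (Hv k.+1))).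
have jC : j%:R != 0 :> C by rewrite pnatr_eq0 -lt0n.
have -> : cardK j.+1 zeta = j%:R^-1 * (zeta * cardK j zeta + h%:C%C^-1 * v%:C%C +
    ((j.+1%:R - zeta) * cardK j (zeta - 1) - h%:C%C^-1 * v%:C%C)).
  by rewrite cardKS//; field; rewrite hC jC.
apply: has_cint_ext (has_cintZ j%:R^-1 (has_cintD I1 I2)) => xi.
(* Since loc = zeta + (xi - z) / h, a factor loc against the kernel splits into zeta times the
   kernel plus the constant 1 / h. The constants integrate to mass / h, with opposite signs in the
   two halves of the recursion. *)
have uz : (loc k xi)%:C%C = zeta + (xi%:C%C - z) / h%:C%C.
  by rewrite /zeta /loc rmorphB rmorphM rmorphB fmorphV /= natrC; field.
(* The kernel may be singular at a real xi = z, but only left of the knot, where the B-spline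
   vanishes. *)
have cell i : cardB j (loc i xi) = 0 \/ knot i <= xi.
  have [|l0] := ltP (loc i xi) 0.
    by move=> l0; left; rewrite cardB_out// negb_and -ltNge l0.
  right; move: l0; rewrite /loc /knot subr_ge0 ler_pdivlMr//.
  by lra.
have nz i : below (knot i) z -> knot i <= xi -> xi%:C%C - z != 0.
  move=> b Ai; apply/eqP => /eqP; rewrite subr_eq0 => /eqP e.
  by case: b; rewrite -e /= ?ltxx// => -[_ /(le_lt_trans Ai)]; rewrite ltxx.
have E1 : zeta * ((xi%:C%C - z)^-1 * (cardB j (loc k xi))%:C%C) +
    h%:C%C^-1 * (cardB j (loc k xi))%:C%C =
    (xi%:C%C - z)^-1 * ((loc k xi)%:C%C * (cardB j (loc k xi))%:C%C).
  case: (cell k) => [->|Ak]; first by rewrite rmorph0 !mulr0 addr0.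
  by rewrite uz; field; rewrite hC (nz k).
have E2 : (j.+1%:R - zeta) * ((xi%:C%C - z)^-1 * (cardB j (loc k.+1 xi))%:C%C) -
    h%:C%C^-1 * (cardB j (loc k.+1 xi))%:C%C =
    (xi%:C%C - z)^-1 * ((j.+1%:R - (loc k xi)%:C%C) * (cardB j (loc k.+1 xi))%:C%C).
  case: (cell k.+1) => [->|Ak]; first by rewrite rmorph0 !mulr0 subr0.
  by rewrite uz; field; rewrite hC (nz k.+1).
rewrite E1 E2 cardBS// -locS.
have G (p q u : R) (w : C) : j%:R^-1 * (w * (u%:C%C * p%:C%C) +
    w * ((j.+1%:R - u%:C%C) * q%:C%C)) =
    w * ((u * p + (j.+1%:R - u) * q) / j%:R)%:C%C.
  by rewrite rmorphM rmorphD !rmorphM rmorphB fmorphV /= !natrC; ring.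
exact: G.
Qed.

End CauchyIntegral.

(** * Spline expansions as quasi-Herglotz functions *)

Section CauchyHerglotz.
Variable R : realType.
Local Notation C := R[i].

(** The order of [C] only compares numbers with equal imaginary parts, so the epsilon of a limit in
    [C] is a positive real. *)
Lemma gt0_complexE (e : C) : 0 < e -> e = (complex.Re e)%:C%C /\ 0 < complex.Re e.
Proof.
case: e => a b; rewrite ltcE /= => /andP[/eqP b0 a0]; split => //.
by apply/eqP; rewrite eq_complex /= b0 !eqxx.
Qed.

Lemma measurable_cauchy_kernel (z : C) : UHP z ->
  measurable_fun setT (fun xi : R => complex.Re (xi%:C%C - z)^-1) /\
  measurable_fun setT (fun xi : R => complex.Im (xi%:C%C - z)^-1).
Proof.
case: z => x y y0.
have q0 (s : R) : (s - x) ^+ 2 + y ^+ 2 != 0.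
  by rewrite gt_eqF// ltr_wpDl ?sqr_ge0// exprn_gt0.
have dq (s : R) : is_derive s 1 (fun s : R => (s - x) ^+ 2 + y ^+ 2) (2 * (s - x)).
  by apply: is_derive_eq; rewrite /GRing.scale /=; ring.
have dV (s : R) : is_derive s 1 (fun s : R => ((s - x) ^+ 2 + y ^+ 2)^-1)
    (- ((s - x) ^+ 2 + y ^+ 2) ^- 2 *: (2 * (s - x))).
  by apply: is_deriveV; rewrite q0.
have cm (f : R -> R) : (forall s : R, exists df : R, is_derive s 1 f df) ->
    measurable_fun setT f.
  move=> H; apply: continuous_measurable_fun => s; have [d [ds _]] := H s.
  exact/differentiable_continuous/derivable1_diffP.
split.
- rewrite (_ : (fun _ => _) = (fun s => (s - x) / ((s - x) ^+ 2 + y ^+ 2))); last first.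
    by apply/funext => s; rewrite invc_sub.
  apply: cm => s; have H := dV s; eexists; apply: is_derive_eq; reflexivity.
- rewrite (_ : (fun _ => _) = (fun s => y / ((s - x) ^+ 2 + y ^+ 2))); last first.
    by apply/funext => s; rewrite invc_sub.
  apply: cm => s; have H := dV s; eexists; apply: is_derive_eq; reflexivity.
Qed.

Lemma cabs_kernel_ge (xi : R) (z : C) : UHP z -> complex.Im z <= cabs (xi%:C%C - z).
Proof.
move=> z0; apply: le_trans (Im_le_cabs _).
by case: z z0 => x y y0; rewrite /= sub0r normrN ler_norm.
Qed.

(** Differentiation under the integral sign: the derivative is the integral of b / (xi - z)^2, and
    the remainder is an explicit integral of size O(eta^2). *)
Lemma cauchy_holomorphic (b g : R -> R) (v : R) (f : C -> C) :
  (forall xi, `|b xi| <= g xi) -> has_int g v ->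
  (forall z, UHP z -> has_cint (fun xi => (xi%:C%C - z)^-1 * (b xi)%:C%C) (f z)) ->
  holomorphic_UHP f.
Proof.
move=> bg gv Hf z z0; set y := complex.Im z.
have y0 : 0 < y by [].
have kn (xi : R) (w : C) : UHP w -> xi%:C%C - w != 0.
  by move=> w0; rewrite -cabs_gt0; exact: lt_le_trans w0 (cabs_kernel_ge _ w0).
have g0 xi : 0 <= g xi by exact: le_trans (bg xi).
have v0 : 0 <= v by apply: has_int_ge0 gv.
have [D HD] : exists D : C, has_cint (fun xi => (xi%:C%C - z)^-1 * ((xi%:C%C - z)^-1 * (b xi)%:C%C)) D.
  have [mr mi] := measurable_cauchy_kernel z0.
  have [/has_int_measurable fr /has_int_measurable fi] := Hf z z0.
  apply: (has_cint_dominated _ _ _ (has_intZ (y^-1 * y^-1) gv)).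
  - rewrite (_ : (fun _ => _) = (fun xi : R => complex.Re (xi%:C%C - z)^-1 *
      complex.Re ((xi%:C%C - z)^-1 * (b xi)%:C%C) - complex.Im (xi%:C%C - z)^-1 *
      complex.Im ((xi%:C%C - z)^-1 * (b xi)%:C%C))); last first.
      by apply/funext => xi; case: ((xi%:C%C - z)^-1) => p q; case: (_ * (b xi)%:C%C).
    by apply: measurable_funB; apply: measurable_funM.
  - rewrite (_ : (fun _ => _) = (fun xi : R => complex.Re (xi%:C%C - z)^-1 *
      complex.Im ((xi%:C%C - z)^-1 * (b xi)%:C%C) + complex.Im (xi%:C%C - z)^-1 *
      complex.Re ((xi%:C%C - z)^-1 * (b xi)%:C%C))); last first.
      by apply/funext => xi; case: ((xi%:C%C - z)^-1) => p q; case: (_ * (b xi)%:C%C).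
    by apply: measurable_funD; apply: measurable_funM.
  - move=> xi; rewrite !cabsM cabsV cabs_real mulrA.
    have i1 : (cabs (xi%:C%C - z))^-1 <= y^-1.
      by rewrite lef_pV2 ?posrE ?cabs_kernel_ge// (lt_le_trans y0)// cabs_kernel_ge.
    have i0 : 0 <= (cabs (xi%:C%C - z))^-1 by rewrite invr_ge0 cabs_ge0.
    by apply: ler_pM; rewrite ?mulr_ge0//; apply: ler_pM.
(* The remainder has integrand eta^2 b / ((xi - z)^2 (xi - z - eta)). The moduli of the three
   factors below are at least y, y and y / 2, giving 2 / y^3; [has_cint_norm_le] doubles it. *)
have key (eta : C) : cabs eta < y / 2 ->
    cabs (f (eta + z) - f z - eta * D) <= cabs eta ^+ 2 * (4 / y ^+ 3 * v).
  move=> he.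
  have ime : `|complex.Im eta| < y / 2 by exact: le_lt_trans (Im_le_cabs _) he.
  have imz : complex.Im (eta + z) = complex.Im eta + y by rewrite /y; case: (eta) (z) => ? ? [].
  have w2 : y / 2 <= complex.Im (eta + z).
    by rewrite imz; move: ime; rewrite ltr_norml => /andP[]; lra.
  have w0 : UHP (eta + z) by rewrite /UHP /=; lra.
  have H := has_cintB (has_cintB (Hf _ w0) (Hf _ z0)) (has_cintZ eta HD).
  have := has_cint_norm_le (g := fun xi => cabs eta ^+ 2 * (2 / y ^+ 3) * g xi) _ H (has_intZ _ gv).
  move=> /(_ _)/le_trans h; apply: h; last first.
    by rewrite le_eqVlt; apply/orP; left; apply/eqP; field; rewrite gt_eqF.
  move=> xi.
  have -> : (xi%:C%C - (eta + z))^-1 * (b xi)%:C%C - (xi%:C%C - z)^-1 * (b xi)%:C%C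
     - eta * ((xi%:C%C - z)^-1 * ((xi%:C%C - z)^-1 * (b xi)%:C%C)) =
     eta * eta * ((xi%:C%C - z)^-1 * (xi%:C%C - z)^-1 * (xi%:C%C - (eta + z))^-1) * (b xi)%:C%C.
    by field; rewrite !kn.
  rewrite !cabsM !cabsV cabs_real expr2.
  have i1 : (cabs (xi%:C%C - z))^-1 <= y^-1.
    by rewrite lef_pV2 ?posrE ?cabs_kernel_ge// (lt_le_trans y0)// cabs_kernel_ge.
  have i2 : (cabs (xi%:C%C - (eta + z)))^-1 <= 2 / y.
    rewrite -[leRHS]invf_div lef_pV2 ?posrE ?divr_gt0//.
      by apply: (le_trans w2); exact: cabs_kernel_ge.
    by apply: (@lt_le_trans _ _ (y / 2)); rewrite ?divr_gt0//; apply: (le_trans w2); exact: cabs_kernel_ge.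
  have i0 w : 0 <= (cabs (w : C))^-1 by rewrite invr_ge0 cabs_ge0.
  apply: ler_pM => //; first by rewrite !mulr_ge0 ?cabs_ge0.
  rewrite ler_wpM2l ?mulr_ge0 ?cabs_ge0//.
  have -> : 2 / y ^+ 3 = y^-1 * y^-1 * (2 / y) by field; rewrite gt_eqF.
  by apply: ler_pM; rewrite ?mulr_ge0//; apply: ler_pM.
rewrite /derivable; apply: (cvgP (D : C^o)); apply/cvgrPdist_lt => e /gt0_complexE[-> e0].
set B := 4 / y ^+ 3 * v in key.
have B0 : 0 <= B by rewrite mulr_ge0// divr_ge0// exprn_ge0// ltW.
set d := Num.min (y / 2) (complex.Re e / (B + 1)).
have d0 : 0 < d by rewrite lt_min !divr_gt0//; lra.
near=> eta.
have en0 : eta != 0 by near: eta; exact: nbhs_dnbhs_neq.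
have ed : cabs eta < d.
  by rewrite -ltcR cabsE; near: eta; apply: dnbhs0_lt; rewrite ltcR.
have [e1 e2] : cabs eta < y / 2 /\ cabs eta < complex.Re e / (B + 1).
  by move: ed; rewrite lt_min => /andP.
rewrite -cabsE ltcR.
have -> : eta *: (1 : C^o) = eta by rewrite /GRing.scale /= mulr1.
rewrite cabsC.
have -> : eta^-1 *: ((f (eta + z) - f z) : C^o) - D = eta^-1 * (f (eta + z) - f z - eta * D).
  by rewrite /GRing.scale /=; field.
have ep : 0 < cabs eta by rewrite cabs_gt0.
rewrite cabsM cabsV ltr_pdivrMl//.
apply: le_lt_trans (key eta e1) _; rewrite expr2 -mulrA ltr_pM2l//.
move: e2; rewrite ltr_pdivlMr; last by lra.
by apply: le_lt_trans; rewrite ler_wpM2l ?cabs_ge0//; lra.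
Unshelve. all: by end_near. Qed.

Lemma cauchy_Herglotz (b : R -> R) (v : R) (f : C -> C) :
  (forall xi, 0 <= b xi) -> has_int b v ->
  (forall z, UHP z -> has_cint (fun xi => (xi%:C%C - z)^-1 * (b xi)%:C%C) (f z)) ->
  Herglotz f.
Proof.
move=> b0 bv Hf; split.
  by apply: (cauchy_holomorphic (g := b) _ bv Hf) => xi; rewrite ger0_norm.
move=> z z0; have [_ Hi] := Hf z z0; apply: has_int_ge0 Hi => xi.
rewrite invc_sub /= mulr0 add0r mulr_ge0// divr_ge0//; first exact: ltW.
by rewrite addr_ge0 ?sqr_ge0.
Qed.

End CauchyHerglotz.

(** * Membership of spline transforms in [W_m] *)

Section SplineQuasiHerglotz.
Variables (R : realType) (t0 h : R) (m : nat).
Local Notation C := R[i].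
Hypotheses (h0 : 0 < h) (m2 : (2 <= m)%N).

Let m0 : (0 < m)%N. Proof. exact: ltnW. Qed.

Definition spline_cauchy (k : nat) (z : C) : C :=
  cardK m ((z - t0%:C%C) / h%:C%C - k%:R).

Definition spline_comb n (c : 'I_n -> R) (z : C) : C :=
  \sum_(k < n) (c k)%:C%C * spline_cauchy k z.

Lemma spline_comb_cint n (c : 'I_n -> R) z : UHP z ->
  has_cint (fun xi => (xi%:C%C - z)^-1 *
     (\sum_(k < n) c k * cardB m ((xi - t0) / h - k%:R))%:C%C) (spline_comb c z).
Proof.
move=> z0; have S := has_cint_sum (index_enum 'I_n) (fun k : 'I_n =>
  has_cintZ (c k)%:C%C (cauchy_spline h0 m0 (or_introl z0 : below (t0 + k%:R * h) z))).
apply: has_cint_ext S => xi; rewrite rmorph_sum mulr_sumr /=.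
by apply: eq_bigr => k _; rewrite [in RHS]rmorphM mulrCA.
Qed.

Lemma spline_comb_int n (c : 'I_n -> R) : exists v : R,
  has_int (fun xi => \sum_(k < n) c k * cardB m ((xi - t0) / h - k%:R)) v.
Proof.
have [v _ Hv] := spline_mass t0 h0 m0.
by eexists; apply: (has_int_sum (index_enum 'I_n) (fun k : 'I_n => has_intZ (c k) (Hv k))).
Qed.

Lemma spline_comb_Herglotz n (c : 'I_n -> R) : (forall k, 0 <= c k) ->
  Herglotz (spline_comb c).
Proof.
move=> c0; have [v Hv] := spline_comb_int c.
apply: (cauchy_Herglotz _ Hv (spline_comb_cint c)) => xi.
by apply: sumr_ge0 => k _; rewrite mulr_ge0// cardB_ge0.
Qed.

(** The sign is split on the coefficients: as [cardB] is nonnegative, both parts have nonnegative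
    densities and stay in the span of the same B-splines. *)
Lemma spline_comb_quasi_Herglotz n (c : 'I_n -> R) : quasi_Herglotz (spline_comb c).
Proof.
exists (spline_comb (fun k => Num.max (c k) 0)), (spline_comb (fun k => Num.max (- c k) 0)).
split; [|split].
- by apply: spline_comb_Herglotz => k; rewrite le_max lexx orbT.
- by apply: spline_comb_Herglotz => k; rewrite le_max lexx orbT.
- move=> z _; rewrite /spline_comb -sumrB; apply: eq_bigr => k _.
  rewrite -mulrBl -rmorphB; congr (_%:C%C * _).
  by rewrite /Num.max; case: ltP => a; case: ltP => b; lra.
Qed.

Lemma spline_comb_loc_Holder n (c : 'I_n -> R) (al : R) : 0 < al < 1 ->
  loc_Holder_on (@UHPc R) al (spline_comb c).
Proof.
move=> al01; apply: loc_Holder_sum => k; apply: loc_HolderZ => //.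
have HK := cardK_loc_Holder al01 m2.
have HA : forall z : C, UHPc z -> UHPc (h^-1%:C%C * z + (- (t0 / h) - k%:R)%:C%C).
  move=> [x y]; rewrite /UHPc /= mul0r addr0 addr0 => y0.
  by rewrite mulr_ge0// invr_ge0 ltW.
apply: loc_Holder_ext (loc_Holder_affine HA HK) => z _.
rewrite /spline_cauchy rmorphB rmorphN rmorphM !fmorphV /= natrC.
by congr (cardK m _); ring.
Qed.

(** The kernel of the representation is the Cauchy kernel minus xi / (1 + xi^2). The subtracted term
    integrates against the density to a finite constant [a], which is added back, with b = 0. *)
Lemma spline_comb_repr n (c : 'I_n -> R) : Bspline_repr m (spline_comb c).
Proof.
set b := fun xi => \sum_(k < n) c k * cardB m ((xi - t0) / h - k%:R).
have [v Hv] := spline_comb_int (fun k => `|c k|).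
have mb : measurable_fun setT b by have [u /has_int_measurable] := spline_comb_int c.
have mk : measurable_fun setT (fun xi : R => xi / (1 + xi ^+ 2)).
  (* The compensating term is the real part of the Cauchy kernel at z = i. *)
  have i0 : UHP ('i%C : C) by rewrite /UHP /= ltr01.
  have [mr _] := measurable_cauchy_kernel i0.
  rewrite (_ : (fun _ => _) = (fun xi : R => complex.Re (xi%:C%C - 'i%C)^-1))//.
  by apply/funext => xi; rewrite invc_sub /= subr0 expr1n addrC.
have [a Ha] : exists a : R, has_int (fun xi => xi / (1 + xi ^+ 2) * b xi) a.
  apply: has_int_dominated Hv; first exact: measurable_funM.
  move=> xi; rewrite normrM -[leRHS]mul1r; apply: ler_pM => //.
    have q : 0 < 1 + xi ^+ 2 by rewrite ltr_wpDr ?sqr_ge0.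
    rewrite normrM normfV (gtr0_norm q) ler_pdivrMr// mul1r.
    rewrite -[xi ^+ 2]real_normK ?num_real//.
    by have := sqr_ge0 (`|xi| - 1); nra.
  apply: le_trans (ler_norm_sum _ _ _) _; apply: ler_sum => k _.
  by rewrite normrM [`|cardB _ _|]ger0_norm ?cardB_ge0.
exists a, 0, b; split; first by exists t0, h, n, c.
move=> z z0 /=.
have H := has_cintB (spline_comb_cint c z0) (has_cint_real Ha).
have {}H : has_cint (fun xi : R =>
   ((1 / (xi%:C - z) - (xi / (1 + xi ^+ 2))%:C) * (b xi)%:C)%C) (spline_comb c z - a%:C%C).
  apply: has_cint_ext H => xi.
  have E (w : C) (p q : R) : w * q%:C%C - (p * q)%:C%C = (w - p%:C%C) * q%:C%C.
    by rewrite rmorphM mulrBl.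
  by rewrite div1r; exact: E.
have [I ->] := has_cintE H; split => //.
by rewrite rmorph0 mul0r addr0 addrC subrK.
Qed.

Lemma spline_comb_W_m (Om : set R) (M al : R) n (c : 'I_n -> R) : 0 < al < 1 ->
  (forall x, Om x -> `|x| <= M) ->
  W_m Om al m (fun x => spline_comb c x%:C%C).
Proof.
move=> al01 OmM; have HQ := spline_comb_loc_Holder c al01.
split.
  have [L HL] := HQ M; exists L => x y Ox Oy.
  have Hr (u : R) : UHPc u%:C%C by rewrite /UHPc /=.
  have := HL _ _ (Hr x) (Hr y); rewrite !cabs_real -rmorphB cabs_real.
  by move=> /(_ (OmM _ Ox) (OmM _ Oy)).
exists (spline_comb c); split; last exact: spline_comb_repr.
split; first exact: spline_comb_quasi_Herglotz.
(* The transform is regular up to the whole real line, so R itself serves as neighbourhood and the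
   transform as its own extension. *)
exists setT; split; first exact: openT.
split => //; exists (spline_comb c); split => //; split => //.
move=> r; have [L HL] := HQ r; exists L => z1 z2 E1 E2; apply: HL.
- by case: E1 => [/ltW//|[e _]]; rewrite /UHPc /= e.
- by case: E2 => [/ltW//|[e _]]; rewrite /UHPc /= e.
Qed.

Lemma W_m_W_alpha (Om : set R) (al : R) q : W_m Om al m q -> W_alpha Om al q.
Proof. by move=> [Hq [Q [HQ _]]]; split => //; exists Q. Qed.

End SplineQuasiHerglotz.

(** * Weierstrass approximation *)

Section Weierstrass.
Variable R : realType.
Implicit Types (phi psi : nat -> R) (y M : R) (g : R -> R).

(* Expectation of [phi] under the binomial law of parameters [n] and ['X]:
   the Bernstein operator, by conditioning on one trial. *)
Fixpoint bernstein n phi : {poly R} :=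
  match n with
  | 0%N => (phi 0%N)%:P
  | n'.+1 => (1 - 'X) * bernstein n' phi + 'X * bernstein n' (phi \o succn)
  end.

Lemma bernsteinS n phi y : (bernstein n.+1 phi).[y] =
  (1 - y) * (bernstein n phi).[y] + y * (bernstein n (phi \o succn)).[y].
Proof. by rewrite /= !hornerE. Qed.

Lemma bernstein_le n phi psi y : 0 <= y <= 1 ->
  (forall k, (k <= n)%N -> phi k <= psi k) ->
  (bernstein n phi).[y] <= (bernstein n psi).[y].
Proof.
move=> /andP[y0 y1]; elim: n phi psi => [|n IH] phi psi H.
  by rewrite /= !hornerE H.
rewrite !bernsteinS; apply: lerD; apply: ler_wpM2l; rewrite ?subr_ge0//.
- by apply: IH => k kn; apply: H; exact: leqW.
- by apply: IH => k kn; apply: H.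
Qed.

Lemma bernstein_linear n (a b : R) phi psi y :
  (bernstein n (fun k => a * phi k + b * psi k)).[y] =
  a * (bernstein n phi).[y] + b * (bernstein n psi).[y].
Proof.
elim: n phi psi => [|n IH] phi psi; first by rewrite /= !hornerE.
rewrite !bernsteinS IH (IH (phi \o succn) (psi \o succn)); ring.
Qed.

Lemma bernstein_cst n (c : R) y : (bernstein n (fun=> c)).[y] = c.
Proof.
elim: n => [|n IH]; first by rewrite /= hornerE.
by rewrite bernsteinS (_ : (fun=> c) \o succn = (fun=> c))// IH; ring.
Qed.

(** Squared bias plus variance of the binomial law. The centre [a] is arbitrary because conditioning
    on a success shifts it by one. *)
Lemma bernstein_variance n (a : R) y :
  (bernstein n (fun k => (k%:R - a) ^+ 2)).[y] = (n%:R * y - a) ^+ 2 + n%:R * (y * (1 - y)).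
Proof.
elim: n a => [|n IH] a; first by rewrite /= hornerE mul0r mul0r addr0.
rewrite bernsteinS IH (_ : _ \o succn = (fun k => (k%:R - (a - 1)) ^+ 2)); last first.
  by apply/funext => k /=; rewrite -natr1; congr (_ ^+ 2); ring.
by rewrite IH -natr1; ring.
Qed.

Definition unif_cont_on M g := forall e : R, 0 < e -> exists2 d : R, 0 < d &
  forall x y : R, `|x| <= M -> `|y| <= M -> `|x - y| < d -> `|g x - g y| < e.

Lemma weierstrass M (B : R) g (e : R) : 0 < M -> unif_cont_on M g ->
  (forall x, `|x| <= M -> `|g x| <= B) -> 0 < e ->
  exists P : {poly R}, forall x, `|x| <= M -> `|g x - P.[x]| < e.
Proof.
move=> M0 ug bg e0.
have [d d0 hd] := ug (e / 2) (divr_gt0 e0 (ltr0n _ 2)).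
have B0 : 0 <= B by apply: le_trans (bg 0 _); rewrite ?normr0 ?(ltW M0).
set A := 2 * B * (2 * M / d) ^+ 2.
have A0 : 0 <= A by rewrite mulr_ge0 ?sqr_ge0// mulr_ge0.
have [n n0 hn] : exists2 n : nat, 0 < n%:R :> R & A / n%:R < e / 2.
  have e2 : 0 < e / 2 by rewrite divr_gt0.
  exists (Num.truncn (A / (e / 2))).+1; first by rewrite ltr0n.
  rewrite ltr_pdivrMr ?ltr0n// mulrC -ltr_pdivrMr//.
  have : 0 <= A / (e / 2) by rewrite divr_ge0// ltW.
  by move=> /truncn_itv/andP[].
pose node k : R := - M + 2 * M * (k%:R / n%:R).
exists (bernstein n (g \o node) \Po ((2 * M)^-1 *: ('X + M%:P))) => x xM.
rewrite horner_comp !hornerE; set y := _ * (x + M).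
have yE : x = - M + 2 * M * y by rewrite /y; field; rewrite gt_eqF.
have y01 : 0 <= y <= 1.
  move: xM; rewrite ler_norml => /andP[x1 x2].
  by rewrite /y mulrC divr_ge0 ?ler_pdivrMr/= ?mulr_gt0//; lra.
(* Chebyshev: near x use uniform continuity; at distance at least d the factor ((node k - x) / d)^2
   >= 1 pays for the crude bound 2 B. This is the origin of [A]. *)
have dev k : (k <= n)%N -> `|g (node k) - g x| <= e / 2 + A / n%:R ^+ 2 * (k%:R - n%:R * y) ^+ 2.
  move=> kn; have kn1 : 0 <= (k%:R / n%:R : R) <= 1.
    by rewrite divr_ge0 ?(ltW n0)//= ler_pdivrMr// mul1r ler_nat.
  have nM : `|node k| <= M.
    rewrite /node ler_norml; case/andP: kn1; set s := _ / _ => s0 s1; apply/andP.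
    by split; nra.
  have dE : node k - x = 2 * M / n%:R * (k%:R - n%:R * y).
    by rewrite {1}yE /node; field; rewrite gt_eqF.
  have q0 : 0 <= A / n%:R ^+ 2 * (k%:R - n%:R * y) ^+ 2.
    by rewrite mulr_ge0 ?sqr_ge0// divr_ge0// sqr_ge0.
  have [lt|ge] := ltP `|node k - x| d.
    by apply: le_trans (ltW (hd _ _ nM xM lt)) _; rewrite lerDl.
  apply: (@le_trans _ _ (2 * B)).
    apply: le_trans (ler_normB _ _) _; have := bg _ nM; have := bg _ xM; lra.
  rewrite ler_wpDl ?divr_ge0 ?(ltW e0)//.
  have -> : A / n%:R ^+ 2 * (k%:R - n%:R * y) ^+ 2 = 2 * B * ((node k - x) / d) ^+ 2.
    by rewrite dE /A; field; rewrite !gt_eqF.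
  rewrite ler_peMr ?mulr_ge0//.
  rewrite -[X in _ <= X]real_normK ?num_real// exprn_ege1//.
  by rewrite normrM normfV (gtr0_norm d0) ler_pdivlMr// mul1r.
have bound : (bernstein n (fun k => e / 2 * 1 + A / n%:R ^+ 2 * (k%:R - n%:R * y) ^+ 2)).[y] < e.
  rewrite bernstein_linear bernstein_cst bernstein_variance subrr expr0n add0r mulr1.
  have -> : A / n%:R ^+ 2 * (n%:R * (y * (1 - y))) = A / n%:R * (y * (1 - y)).
    by field; rewrite gt_eqF.
  have : A / n%:R * (y * (1 - y)) <= A / n%:R * 1.
    apply: ler_wpM2l; first by rewrite divr_ge0// ltW.
    by case/andP: y01 => ? ?; nra.
  by lra.
have lin s : (bernstein n (fun k => s * (g (node k) - g x))).[y] =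
    s * ((bernstein n (g \o node)).[y] - g x).
  rewrite -{2}(bernstein_cst n (g x) y).
  have := bernstein_linear n s (- s) (g \o node) (fun=> g x) y.
  rewrite (_ : (fun k => _) = (fun k => s * (g (node k) - g x))); last first.
    by apply/funext => k /=; ring.
  by move=> ->; ring.
(* Monotonicity of the operator is one-sided, so it is applied with s = 1 and s = -1. *)
have dev' s k : `|s| <= 1 -> (k <= n)%N ->
    s * (g (node k) - g x) <= e / 2 * 1 + A / n%:R ^+ 2 * (k%:R - n%:R * y) ^+ 2.
  move=> s1 kn; rewrite mulr1; apply: le_trans (dev k kn); apply: le_trans (ler_norm _) _.
  by rewrite normrM ler_piMl.
have s1 : `|1 : R| <= 1 by rewrite normr1.
have sN1 : `|-1 : R| <= 1 by rewrite normrN1.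
rewrite ltr_norml; apply/andP; split.
- have := le_lt_trans (bernstein_le y01 (fun k => dev' 1 k s1)) bound.
  by rewrite lin mul1r; lra.
- have := le_lt_trans (bernstein_le y01 (fun k => dev' (-1) k sN1)) bound.
  by rewrite lin mulN1r; lra.
Qed.

Lemma continuous_unif_cont_on M g : continuous g -> unif_cont_on M g.
Proof.
move=> cg e e0.
have K : compact (`[- M, M] : set R) by exact: segment_compact.
move/compact_near_coveringP : K => /(_ R 0^'+ (fun d x => forall y, `|x - y| < d -> `|g x - g y| < e)) H.
have e2 : 0 < e / 2 by rewrite divr_gt0.
have : \forall d \near 0^'+, forall x, `[- M, M]%classic x -> forall y, `|x - y| < d -> `|g x - g y| < e.
  apply: H => x _.
  have /cvgrPdist_lt/(_ _ e2) := cg x.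
  rewrite -filter_from_ballE => -[/= r r0 hr].
  exists (ball x (r / 2), [set d | d < r / 2]).
    split; first by apply: nbhsx_ballx; rewrite divr_gt0.
    by apply: nbhs_right_lt; rewrite divr_gt0.
  move=> [x' d] /= [bx dr] y xy.
  have g1 : `|g x - g x'| < e / 2.
    apply: hr; apply: le_ball bx; lra.
  have g2 : `|g x - g y| < e / 2.
    apply: hr; rewrite /ball /= in bx *.
    have := ler_distD x' x y; lra.
  have := ler_distD (g x) (g x') (g y); rewrite [`|g x' - g x|]distrC; lra.
rewrite near_withinE => -[/= d d0 hd].
exists (d / 2); first by rewrite divr_gt0.
move=> x y xM yM xy; apply: (hd (d / 2)) => //.
- by rewrite /ball /= sub0r normrN ger0_norm; lra.
- by rewrite divr_gt0.
- by rewrite /= in_itv /= -ler_norml.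
Qed.

End Weierstrass.

(** * Splines supported far away *)

Section MonomialClosure.
Variables (R : realType) (M : R) (G : nat -> R -> R).
Implicit Types (phi psi : R -> R) (p q : {poly R}).

(* A polynomial serves here as a finitely supported coefficient sequence. *)
Definition comb p (x : R) : R := \sum_(k < size p) p`_k * G k x.

Lemma comb_widen p n x : (size p <= n)%N -> comb p x = \sum_(k < n) p`_k * G k x.
Proof.
move=> pn; rewrite /comb (big_ord_widen n (fun k => p`_k * G k x) pn) big_mkcond.
apply: eq_bigr => k _; case: ltnP => // pk.
by rewrite nth_default ?mul0r.
Qed.

Lemma combD p q x : comb (p + q) x = comb p x + comb q x.
Proof.
rewrite (comb_widen x (leq_maxl (size p) (size q))) (comb_widen x (leq_maxr (size p) (size q))).
rewrite (comb_widen x (size_polyD p q)) -big_split.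
by apply: eq_bigr => k _; rewrite coefD mulrDl.
Qed.

Lemma combZ c p x : comb (c *: p) x = c * comb p x.
Proof.
rewrite (comb_widen x (size_scale_leq c p)) mulr_sumr.
by apply: eq_bigr => k _; rewrite coefZ mulrA.
Qed.

Lemma combXn k x : comb 'X^k x = G k x.
Proof.
rewrite /comb size_polyXn big_ord_recr /= coefXn eqxx mul1r big1 ?add0r// => i _.
by rewrite coefXn ltn_eqF ?mul0r.
Qed.

Definition approximable phi := forall e : R, 0 < e ->
  exists p, forall x, `|x| <= M -> `|phi x - comb p x| < e.

Lemma approximable_comb p : approximable (comb p).
Proof. by move=> e e0; exists p => x _; rewrite subrr normr0. Qed.

Lemma approximableD phi psi : approximable phi -> approximable psi ->
  approximable (fun x => phi x + psi x).
Proof.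
move=> Hphi Hpsi e e0; have e2 : 0 < e / 2 by rewrite divr_gt0.
have [p hp] := Hphi _ e2; have [q hq] := Hpsi _ e2; exists (p + q) => x xM.
rewrite combD opprD addrACA; apply: le_lt_trans (ler_normD _ _) _.
by have := hp x xM; have := hq x xM; lra.
Qed.

Lemma approximableZ c phi : approximable phi -> approximable (fun x => c * phi x).
Proof.
move=> Hphi e e0; have c0 : 0 < `|c| + 1 by rewrite ltr_wpDl.
have [p hp] := Hphi _ (divr_gt0 e0 c0); exists (c *: p) => x xM.
have := hp x xM; rewrite combZ -mulrBr normrM ltr_pdivlMr//.
apply: le_lt_trans; rewrite mulrC ler_wpM2l//; lra.
Qed.

Lemma approximable_sum n (phi : nat -> R -> R) :
  (forall k, (k < n)%N -> approximable (phi k)) ->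
  approximable (fun x => \sum_(k < n) phi k x).
Proof.
elim: n => [|n IH] H.
  move=> e e0; exists 0 => x _.
  by rewrite /comb size_poly0 !big_ord0 subrr normr0.
have := approximableD (IH (fun k kn => H k (leqW kn))) (H n (ltnSn n)).
by congr approximable; apply/funext => x; rewrite big_ord_recr.
Qed.

(** Only the error relative to the leading coefficient is constrained: [mu J] may be tiny and the
    lower coefficients are arbitrary. *)
Hypothesis leading : forall (J : nat) (e : R), 0 < e ->
  exists k (mu : nat -> R), 0 < mu J /\ forall x, `|x| <= M ->
    `|G k x - \sum_(j < J.+1) mu j * x ^+ j| <= e * mu J.

Lemma approximable_monomial J : approximable (fun x => x ^+ J).
Proof.
elim/ltn_ind: J => J IH e e0; have e2 : 0 < e / 2 by rewrite divr_gt0.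
have [k [mu [muJ hk]]] := leading J e2.
have low : approximable (fun x => \sum_(j < J) mu j * x ^+ j).
  apply: (@approximable_sum J (fun j x => mu j * x ^+ j)) => j jJ.
  by apply: approximableZ; exact: IH.
(* The accuracy asked of the lower monomials is chosen after [mu J], so the division by it is
   harmless. *)
have := approximableZ (mu J)^-1 (approximableD (approximable_comb 'X^k) (approximableZ (-1) low)).
move=> /(_ _ e2)[p hp]; exists p => x xM; have := hp x xM; have := hk x xM.
rewrite combXn mulN1r big_ord_recr /= opprD addrA.
set s := G k x - _ => h1 h2.
have h3 : `|x ^+ J - (mu J)^-1 * s| <= e / 2.
  rewrite -(ler_pM2r muJ) -[X in _ * X](gtr0_norm muJ) -normrM.
  rewrite (_ : (_ - _) * mu J = mu J * x ^+ J - s); first by rewrite distrC.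
  by field; rewrite gt_eqF.
have := ler_distD ((mu J)^-1 * s) (x ^+ J) (comb p x); lra.
Qed.

Lemma approximable_poly (P : {poly R}) : approximable (horner P).
Proof.
have := @approximable_sum (size P) (fun j x => P`_j * x ^+ j)
  (fun j _ => approximableZ P`_j (approximable_monomial j)).
by congr approximable; apply/funext => x; rewrite horner_coef.
Qed.

End MonomialClosure.

(** * Taylor expansion of the transforms of far splines *)

Section FarSplines.
Variables (R : realType) (t0 h : R) (m : nat).
Local Notation C := R[i].
Hypotheses (h0 : 0 < h) (m0 : (0 < m)%N).

Lemma Re_spline_cauchy k (x : R) : x < t0 + k%:R * h ->
  has_int (fun xi => (xi - x)^-1 * cardB m ((xi - t0) / h - k%:R))
    (complex.Re (spline_cauchy t0 h m k x%:C%C)).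
Proof.
move=> xk; have [H _] := cauchy_spline h0 m0 (or_intror (conj erefl xk) : below (t0 + k%:R * h) x%:C%C).
apply: has_int_ext H => xi.
by rewrite -rmorphB -fmorphV -rmorphM.
Qed.

Lemma geometric_remainder n (x s : R) : s != 0 -> s - x != 0 ->
  (s - x)^-1 - \sum_(j < n) x ^+ j * s^-1 ^+ j.+1 = x ^+ n * s^-1 ^+ n * (s - x)^-1.
Proof.
move=> s0 sx; elim: n => [|n IH]; first by rewrite big_ord0 subr0 !expr0 !mul1r.
rewrite big_ord_recr /= opprD addrA IH !exprS.
by field; rewrite s0 sx.
Qed.

(* Expanding 1 / (xi - x) in powers of x / xi, uniformly for xi in the support
   of a spline centred far to the right of [- M, M]. *)
Lemma far_spline_leading (M : R) k (J : nat) (e : R) : 0 < M -> 1 <= t0 + k%:R * h ->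
  M < t0 + k%:R * h -> M ^+ J.+1 / (t0 + k%:R * h - M) <= e ->
  exists mu : nat -> R, 0 < mu J /\ forall x, `|x| <= M ->
    `|complex.Re (spline_cauchy t0 h m k x%:C%C) - \sum_(j < J.+1) mu j * x ^+ j| <= e * mu J.
Proof.
move=> M0 X1 XM Xe; set X := t0 + k%:R * h in X1 XM Xe.
(* A real power rather than an inverse: measurable and nonnegative on all of R, and equal to xi^-1
   on the support of the spline. *)
pose w (xi : R) := powR xi (-1).
pose b (xi : R) := cardB m ((xi - t0) / h - k%:R).
have wE xi : 0 <= xi -> w xi = xi^-1 by move=> xi0; rewrite /w powRN powRr1.
have [v v0 Hv] := spline_mass t0 h0 m0.
have b0 xi : 0 <= b xi by exact: cardB_ge0.
have cell xi : b xi = 0 \/ X <= xi <= X + m%:R * h.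
  have [/andP[l0 l1]|out] := boolP ((0 <= (xi - t0) / h - k%:R) && ((xi - t0) / h - k%:R < m%:R)); last first.
    by left; exact: cardB_out.
  right; move: l0 l1; rewrite subr_ge0 ler_pdivlMr// ltrBlDr ltr_pdivrMr// mulrDl /X.
  by move=> *; apply/andP; split; lra.
have w0 xi : 0 <= w xi by exact: powR_ge0.
have /choice[mu Hmu] : forall j : nat, exists u, has_int (fun xi => w xi ^+ j.+1 * b xi) u.
  move=> j; apply: (has_int_dominated _ _ (Hv k)).
    apply: measurable_funM; last exact: has_int_measurable (Hv k).
    by apply: measurable_funX; apply: measurable_powR.
  move=> xi; rewrite ger0_norm ?mulr_ge0 ?exprn_ge0//.
  case: (cell xi) => [->|/andP[Xxi _]]; first by rewrite mulr0 cardB_ge0.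
  have xi1 : 1 <= xi by lra.
  rewrite ler_piMl// exprn_ile1// wE; last by lra.
  by rewrite invf_le1//; lra.
exists mu; split.
  have mh : 0 <= m%:R * h by rewrite mulr_ge0// ltW.
  (* The moment is at least (X + m h)^(-J-1) times the positive mass. *)
  apply: lt_le_trans (has_int_le _ (has_intZ ((X + m%:R * h)^-1 ^+ J.+1) (Hv k)) (Hmu J)).
    by rewrite mulr_gt0// exprn_gt0// invr_gt0; lra.
  move=> xi; rewrite -/(b xi); case: (cell xi) => [->|/andP[x1 x2]]; first by rewrite !mulr0.
  rewrite ler_wpM2r// wE; last by lra.
  by rewrite lerXn2r ?nnegrE ?invr_ge0 ?lef_pV2 ?posrE//; lra.
move=> x xM; have xX : x < X by have := ler_norm x; lra.
have S := has_int_sum (index_enum 'I_J.+1) (fun j : 'I_J.+1 => has_intZ (x ^+ j) (Hmu j)).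
have D := has_intB (Re_spline_cauchy xX) S.
rewrite (eq_bigr (fun j : 'I_J.+1 => x ^+ j * mu j)); last by move=> j _; rewrite mulrC.
apply: has_int_norm_le D (has_intZ e (Hmu J)) => xi; rewrite -/(b xi).
case: (cell xi) => [->|/andP[x1 _]].
  by rewrite !mulr0 big1 ?subrr ?normr0// => j _; rewrite !mulr0.
have xi0 : 0 < xi by lra.
have xix : 0 < xi - x by lra.
rewrite wE ?(ltW xi0)// (eq_bigr (fun j : 'I_J.+1 => x ^+ j * xi^-1 ^+ j.+1 * b xi)); last first.
  by move=> j _; rewrite mulrA.
(* The remainder (x / xi)^(J+1) / (xi - x) is at most M^(J+1) / (X - M) times xi^(-J-1), the very
   weight that integrates to [mu J]; hence a relative error. *)
rewrite -mulr_suml -mulrBl geometric_remainder ?gt_eqF// normrM (ger0_norm (b0 xi)) mulrA.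
rewrite ler_wpM2r// !normrM normrX normrX !normfV (gtr0_norm xi0) (gtr0_norm xix).
rewrite mulrAC ler_wpM2r ?exprn_ge0 ?invr_ge0 ?(ltW xi0)//.
apply: le_trans Xe; apply: ler_pM; rewrite ?exprn_ge0 ?invr_ge0 ?(ltW xix)//.
  by rewrite lerXn2r ?nnegrE//; lra.
by rewrite lef_pV2 ?posrE//; have := ler_norm x; lra.
Qed.

Lemma far_spline_approx (M : R) (n : nat) (P : {poly R}) (e : R) : 0 < M ->
  (forall k, (n <= k)%N -> M < t0 + k%:R * h) -> 0 < e ->
  exists p : {poly R}, forall x, `|x| <= M ->
    `|P.[x] - \sum_(k < size p) p`_k *
       complex.Re (spline_cauchy t0 h m (n + k) x%:C%C)| < e.
Proof.
move=> M0 nM; apply: (@approximable_poly R M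
  (fun k x => complex.Re (spline_cauchy t0 h m (n + k) x%:C%C))) => J d d0.
(* From this knot on, X exceeds both M and 1, and X - M >= M^(J+1) / d is the required smallness. *)
have [k hk] : exists k : nat, M + 1 + M ^+ J.+1 / d <= t0 + k%:R * h.
  exists (Num.truncn `|(M + 1 + M ^+ J.+1 / d - t0) / h|).+1.
  set A := M + 1 + _ - t0.
  have /truncn_itv/andP[_ lt] : 0 <= `|A / h| by [].
  have : A / h < (Num.truncn `|A / h|).+1%:R by apply: le_lt_trans lt; exact: ler_norm.
  by rewrite ltr_pdivrMr// /A; lra.
have q0 : 0 < M ^+ J.+1 / d by rewrite divr_gt0// exprn_gt0.
have hk' : M + 1 + M ^+ J.+1 / d <= t0 + (n + k)%:R * h.
  have nh : 0 <= n%:R * h by rewrite mulr_ge0// ltW.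
  by rewrite natrD mulrDl; lra.
have [|||mu Hmu] := @far_spline_leading M (n + k) J d M0; last by exists k, mu.
- by lra.
- by lra.
- rewrite ler_pdivrMr; last by lra.
  rewrite mulrC -ler_pdivrMr//; lra.
Qed.

End FarSplines.

(** * Uniform approximation *)

Section UniformApproximation.
Variables (R : realType) (m : nat).
Local Notation C := R[i].
Hypothesis m2 : (2 <= m)%N.

Lemma ReB (u v : C) : complex.Re (u - v) = complex.Re u - complex.Re v.
Proof. by case: u v => ? ? []. Qed.

Lemma ImB (u v : C) : complex.Im (u - v) = complex.Im u - complex.Im v.
Proof. by case: u v => ? ? []. Qed.

Lemma Re_sum n (f : 'I_n -> C) : complex.Re (\sum_(k < n) f k) = \sum_(k < n) complex.Re (f k).
Proof. by apply: (big_morph (@complex.Re R)) => // -[? ?] []. Qed.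

Lemma Im_sum n (f : 'I_n -> C) : complex.Im (\sum_(k < n) f k) = \sum_(k < n) complex.Im (f k).
Proof. by apply: (big_morph (@complex.Im R)) => // -[? ?] []. Qed.

Lemma Re_realM (x : R) (z : C) : complex.Re (x%:C%C * z) = x * complex.Re z.
Proof. by case: z => a b; rewrite /= mul0r subr0. Qed.

Lemma unif_cont_onB (M : R) (f g : R -> R) : unif_cont_on M f -> unif_cont_on M g ->
  unif_cont_on M (fun x => f x - g x).
Proof.
move=> Hf Hg e e0; have e2 : 0 < e / 2 by rewrite divr_gt0.
have [d d0 hd] := Hf _ e2; have [d' d'0 hd'] := Hg _ e2.
exists (Num.min d d'); first by rewrite lt_min d0.
move=> x y xM yM; rewrite lt_min => /andP[xy xy'].
rewrite (_ : _ - _ = (f x - f y) - (g x - g y)); last by ring.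
apply: le_lt_trans (ler_normB _ _) _.
by have := hd x y xM yM xy; have := hd' x y xM yM xy'; lra.
Qed.

(** The exponent 1/2 is a convenient choice: its modulus of continuity is a square root. *)
Lemma loc_Holder_unif_cont_on (M : R) (f : C -> C) :
  loc_Holder_on (@UHPc R) 2^-1 f ->
  unif_cont_on M (fun x => complex.Re (f x%:C%C)).
Proof.
move=> /loc_Holder_ge0 Hf e e0; have [L L0 HL] := Hf M.
have L1 : 0 < L + 1 by lra.
exists ((e / (L + 1)) ^+ 2); first by rewrite exprn_gt0// divr_gt0.
move=> x y xM yM xy; rewrite -ReB; apply: le_lt_trans (Re_le_cabs _) _.
have Hr (u : R) : UHPc u%:C%C by rewrite /UHPc /=.
have := HL _ _ (Hr x) (Hr y); rewrite !cabs_real -rmorphB cabs_real => /(_ xM yM).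
move=> /le_lt_trans; apply; rewrite powR12_sqrt//.
have : Num.sqrt `|x - y| < e / (L + 1).
  rewrite -[ltRHS]ger0_norm ?divr_ge0 ?(ltW e0) ?(ltW L1)// -[ltRHS]sqrtr_sqr ltr_sqrt//.
  by rewrite exprn_gt0// divr_gt0.
rewrite ltr_pdivlMr// => h; apply: le_lt_trans h; rewrite mulrC ler_wpM2l ?sqrtr_ge0//.
by rewrite lerDl.
Qed.

Lemma Im_spline_comb_real (t0 h : R) n (c : 'I_n -> R) (x : R) : 0 < h ->
  complex.Im (spline_comb t0 h m c x%:C%C) =
  \sum_(k < n) pi * c k * cardB m ((x - t0) / h - k%:R).
Proof.
move=> h0; rewrite Im_sum; apply: eq_bigr => k _; rewrite Im_realM /spline_cauchy.
rewrite (_ : _ - k%:R = ((x - t0) / h - k%:R)%:C%C); last first.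
  by rewrite rmorphB rmorphM rmorphB fmorphV /= natrC.
by rewrite Im_cardK_real//; ring.
Qed.

(** The coefficients sample [g] at the left ends of the supports, divided by pi to undo
    [Im_cardK_real]. Supports have length at most 1, whence the interval of radius M + 1. The clause
    on k >= n reserves the rest of the grid for the real correction. *)
Lemma quasi_interpolation (M : R) (g : R -> R) (e : R) : 0 < M ->
  unif_cont_on (M + 1) g -> 0 < e ->
  exists (t0 h : R) n (c : 'I_n -> R), [/\ 0 < h,
    forall k, (n <= k)%N -> M < t0 + k%:R * h &
    forall x, `|x| <= M -> `|complex.Im (spline_comb t0 h m c x%:C%C) - g x| < e].
Proof.
move=> M0 ug e0; have e2 : 0 < e / 2 by rewrite divr_gt0.
have [d d0 hd] := ug _ e2.
have mR : 0 < m%:R :> R by rewrite ltr0n; exact: ltnW.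
set l := Num.min 1 (d / 2).
have l0 : 0 < l by rewrite lt_min ltr01 divr_gt0.
have [l1 ld] : l <= 1 /\ l < d.
  by rewrite /l; split; rewrite ?ge_min ?lexx// gt_min; apply/orP; right; lra.
pose h := l / m%:R; have h0 : 0 < h by rewrite divr_gt0.
have mh : m%:R * h = l by rewrite /h; field; rewrite gt_eqF.
(* The grid starts one support length before - M, so that x >= - M yields u >= m and a complete
   partition of unity. *)
pose t0 := - M - l.
have [n hn] : exists n : nat, M - t0 < n%:R * h.
  exists (Num.truncn ((M - t0) / h)).+1; rewrite -ltr_pdivrMr//.
  have /truncn_itv/andP[] // : 0 <= (M - t0) / h.
  by rewrite divr_ge0 ?(ltW h0)// /t0; lra.
exists t0, h, n, (fun k => g (t0 + k%:R * h) / pi); split => //.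
  move=> k nk; have : n%:R * h <= k%:R * h by rewrite ler_pM2r// ler_nat.
  by lra.
move=> x xM; rewrite Im_spline_comb_real//.
have [x1 x2] : - M <= x /\ x <= M by move: xM; rewrite ler_norml => /andP.
set u := (x - t0) / h.
have um : m%:R - 1 <= u.
  have : m%:R <= u by rewrite /u ler_pdivlMr// mh /t0; lra.
  by lra.
have un : u < n%:R by rewrite /u ltr_pdivrMr//; lra.
have part := cardB_partition (ltnW m2 : (0 < m)%N) um un.
have -> : g x = \sum_(k < n) g x * cardB m (u - k%:R) by rewrite -mulr_sumr part mulr1.
rewrite -sumrB; apply: (@le_lt_trans _ _ (e / 2)); last by lra.
rewrite (_ : e / 2 = \sum_(k < n) e / 2 * cardB m (u - k%:R)); last first.
  by rewrite -mulr_sumr part mulr1.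
apply: le_trans (ler_norm_sum _ _ _) _.
apply: ler_sum => k _.
rewrite [pi * _]mulrC divfK ?gt_eqF ?pi_gt0// -mulrBl normrM [`|cardB _ _|]ger0_norm ?cardB_ge0//.
have [/andP[k1 k2]|out] := boolP ((0 <= u - k%:R) && (u - k%:R < m%:R)); last first.
  by rewrite cardB_out// !mulr0.
rewrite ler_wpM2r ?cardB_ge0//; apply/ltW.
have xk : x - (t0 + k%:R * h) = (u - k%:R) * h by rewrite /u; field; rewrite gt_eqF.
have xk0 : 0 <= x - (t0 + k%:R * h) by rewrite xk mulr_ge0// ltW.
have xkl : x - (t0 + k%:R * h) < l by rewrite xk -mh ltr_pM2r.
apply: hd.
- by rewrite ler_norml; apply/andP; split; rewrite /t0 in xk0 xkl *; lra.
- by lra.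
- by rewrite distrC ger0_norm//; lra.
Qed.

Lemma spline_uniform_approx (M B : R) (gR gI : R -> R) (e : R) : 0 < M ->
  unif_cont_on M gR -> (forall x, `|x| <= M -> `|gR x| <= B) ->
  unif_cont_on (M + 1) gI -> 0 < e ->
  exists (t0 h : R) n (c : 'I_n -> R), 0 < h /\ forall x, `|x| <= M ->
    cabs (spline_comb t0 h m c x%:C%C - (gR x +i* gI x)%C) <= e.
Proof.
(* Three errors below e / 4 will be added: one imaginary, and two real ones from the polynomial and
   from the far splines. *)
move=> M0 uR bR uI e0; have e4 : 0 < e / 4 by rewrite divr_gt0.
have [t0 [h [n [c [h0 nM HI]]]]] := quasi_interpolation M0 uI e4.
have al : 0 < (2^-1 : R) < 1 by lra.
have HH := spline_comb_loc_Holder t0 h0 m2 c al.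
have [B' B'0 HB'] := loc_Holder_bounded al HH M.
(* The real part of the interpolant may be large, but its Hölder continuity makes the real error an
   admissible target for [weierstrass]. *)
have ur := unif_cont_onB uR (loc_Holder_unif_cont_on M HH).
have br x : `|x| <= M -> `|gR x - complex.Re (spline_comb t0 h m c x%:C%C)| <= B + B'.
  move=> xM; apply: le_trans (ler_normB _ _) _; apply: lerD; first exact: bR.
  by apply: le_trans (Re_le_cabs _) _; apply: HB'; rewrite ?cabs_real// /UHPc /=.
have [P HP] := weierstrass M0 ur br e4.
have [p Hp] := far_spline_approx h0 (ltnW m2 : (0 < m)%N) P M0 nM e4.
exists t0, h, (n + size p)%N, (fun k => match fintype.split k with inl i => c i | inr i => p`_i end).
split => // x xM.
set S := spline_comb t0 h m _ _.
have SE : S = spline_comb t0 h m c x%:C%C +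
    \sum_(k < size p) (p`_k)%:C%C * spline_cauchy t0 h m (n + k) x%:C%C.
  rewrite /S /spline_comb big_split_ord /=; congr (_ + _); apply: eq_bigr => k _.
    by rewrite (unsplitK (inl k)).
  by rewrite (unsplitK (inr k)).
have sRe : complex.Re S = complex.Re (spline_comb t0 h m c x%:C%C) +
    \sum_(k < size p) p`_k * complex.Re (spline_cauchy t0 h m (n + k) x%:C%C).
  rewrite SE; have ReD (u v : C) : complex.Re (u + v) = complex.Re u + complex.Re v by case: u v => ? ? [].
  by rewrite ReD; congr (_ + _); rewrite Re_sum; apply: eq_bigr => k _; rewrite Re_realM.
(* On the real line the imaginary part is pi times the density, and the far splines vanish on
   [- M, M]. *)
have sIm : complex.Im S = complex.Im (spline_comb t0 h m c x%:C%C).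
  rewrite SE; have ImD (u v : C) : complex.Im (u + v) = complex.Im u + complex.Im v by case: u v => ? ? [].
  rewrite ImD -[RHS]addr0; congr (_ + _); rewrite Im_sum big1// => k _.
  rewrite Im_realM /spline_cauchy.
  rewrite (_ : _ - (n + k)%:R = ((x - t0) / h - (n + k)%:R)%:C%C); last first.
    by rewrite rmorphB rmorphM rmorphB fmorphV /= natrC.
  rewrite Im_cardK_real// cardB_out ?mulr0// negb_and -ltNge; apply/orP; left.
  rewrite subr_lt0 ltr_pdivrMr//; have := nM (n + k)%N (leq_addr _ _); have := ler_norm x; lra.
apply: le_trans (cabs_le_ReIm _) _; rewrite ReB ImB sRe sIm /=.
have := HI x xM; have := HP x xM; have := Hp x xM.
set a := complex.Re _; set s := \sum_(_ < _) _ => h1 h2 h3.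
have h4 : `|a + s - gR x| <= `|P.[x] - s| + `|gR x - a - P.[x]|.
  rewrite (_ : a + s - gR x = - (P.[x] - s) - (gR x - a - P.[x])); last by ring.
  by apply: le_trans (ler_normB _ _) _; rewrite normrN.
by lra.
Qed.

End UniformApproximation.

(** * The weighted norms *)

Section Omega.
Variable R : realType.
Implicit Type s : seq (R * R).

Lemma Omega_of_cons a s : Omega_of (a :: s) = `[a.1, a.2]%classic `|` Omega_of s.
Proof.
apply/seteqP; split => x; rewrite /Omega_of /= in_itv /=.
  by move=> /orP[]; [left|right].
by move=> [->//|->]; rewrite orbT.
Qed.

Lemma compact_Omega_of s : compact (Omega_of s).
Proof.
elim: s => [|a s IH].
  rewrite (_ : Omega_of [::] = set0); first exact: compact0.
  by apply/seteqP; split => x.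
by rewrite Omega_of_cons; apply: compactU => //; exact: segment_compact.
Qed.

Lemma compact_norm_bounded (A : set R) (f : R -> R) : compact A ->
  {within A, continuous f} -> exists2 B : R, 0 < B & forall x, A x -> `|f x| <= B.
Proof.
move=> cA cf; have /compact_bounded[B [_ HB]] := continuous_compact cf cA.
exists (`|B| + 1); first by rewrite ltr_wpDl.
move=> x Ax; apply: (HB (`|B| + 1)); last by exists x.
by have := ler_norm B; lra.
Qed.

Lemma continuous_extension (A : set R) (f : R -> R) : compact A ->
  {within A, continuous f} -> exists (g : R -> R) (B : R),
    [/\ forall x, A x -> f x = g x, continuous g & forall x, `|g x| <= B].
Proof.
move=> cA cf; have [B B0 HB] := compact_norm_bounded cA cf.
have clA : closed A by apply: compact_closed => //; exact: Rhausdorff.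
have [g [fg cg bg]] := continuous_bounded_extension (@pseudometric_normal R R) clA B0 cf HB.
by exists g, B; split => // x Ax; apply: fg; rewrite inE.
Qed.

Lemma within_continuous_ReIm (A : set R) (F : R -> R[i]) :
  {within A, continuous (F : R -> (R[i])^o)} ->
  {within A, continuous (fun x => complex.Re (F x))} /\
  {within A, continuous (fun x => complex.Im (F x))}.
Proof.
move=> cF; split => x; apply/cvgrPdist_lt => e e0;
  have /cvgrPdist_lt/(_ e%:C%C) := cF x; rewrite ltcR => /(_ e0); apply: filterS => y;
  rewrite -cabsE ltcR; apply: le_lt_trans.
- by apply: le_trans (Re_le_cabs _); rewrite ReB.
- by apply: le_trans (Im_le_cabs _); rewrite ImB.
Qed.

End Omega.

(** * Comparison with the uniform norm, and the degenerate essential supremum *)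

Section LpNorm.
Variable R : realType.
Local Notation C := R[i].
Local Notation mu := (@lebesgue_measure R).

(* A nonnegative integral is a supremum over the simple functions below the
   integrand, measurable or not. *)
Lemma ge0_subset_le_integral (D : set R) (f g : R -> \bar R) :
  (forall x, D x -> 0 <= f x)%E -> (forall x, D x -> f x <= g x)%E ->
  (\int[mu]_(x in D) f x <= \int[mu]_(x in D) g x)%E.
Proof.
move=> f0 fg; rewrite !ge0_integralE//; last first.
  by move=> x Dx; exact: le_trans (f0 x Dx) (fg x Dx).
apply: le_ereal_sup => _ [phi Hphi <-]; exists phi => // x.
apply: le_trans (Hphi x) _; rewrite /patch; case: ifPn => //.
by rewrite inE => /fg.
Qed.

(** K is W for p = +oo and the power 1/p of W times the measure of [Om] otherwise; its independence
    of [f] turns uniform density into density for these norms. *)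
Lemma Lp_norm_small (Om : set R) (w : R -> R) (p : \bar R) (W : R) :
  measurable Om -> (mu Om < +oo)%E -> (forall x, Om x -> 0 < w x) ->
  (forall x, Om x -> `|w x| <= W) -> 0 < W -> (1 <= p)%E ->
  exists2 K : R, 0 <= K & forall (f : R -> C) e, 0 <= e ->
    (forall x, Om x -> cabs (f x) <= e) -> (Lp_norm Om w p f <= (K * e)%:E)%E.
Proof.
move=> mOm fOm w0 wW W0; have wW' x : Om x -> w x <= W.
  by move=> /wW; apply: le_trans; exact: ler_norm.
case: p => [r| |]//.
- rewrite lee_fin => r1; have r0 : 0 < r by lra.
  have mfin : mu Om \is a fin_num by rewrite ge0_fin_numE.
  set V := fine (mu Om); have V0 : 0 <= V by rewrite fine_ge0.
  exists (powR (W * V) r^-1); first exact: powR_ge0.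
  move=> f e e0 fe /=.
  have -> : ((powR (W * V) r^-1 * e)%:E = (((W * powR e r) * V)%:E `^ r^-1)%E)%E.
    rewrite poweR_EFin mulrAC [in RHS]powRM ?powR_ge0 ?mulr_ge0 ?(ltW W0)//.
    by rewrite -powRrM divff ?gt_eqF// powRr1.
  apply: gt0_ler_poweR; first by rewrite invr_ge0 ltW.
  + rewrite in_itv /= leey andbT; apply: integral_ge0 => x Ox.
    by rewrite lee_fin mulr_ge0 ?powR_ge0// ltW// w0.
  + by rewrite in_itv /= leey andbT lee_fin !mulr_ge0 ?powR_ge0// ltW.
  + apply: (@le_trans _ _ (\int[mu]_(x in Om) (W * powR e r)%:E)%E).
      apply: ge0_subset_le_integral => x Ox; rewrite lee_fin.
        by rewrite mulr_ge0 ?powR_ge0// ltW// w0.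
      apply: ler_pM; rewrite ?powR_ge0 ?(ltW (w0 _ Ox)) ?wW'//.
      by apply: ge0_ler_powR; rewrite ?nnegrE ?cabs_ge0 ?(ltW r0) ?fe.
    by rewrite integral_cst// [in leRHS]EFinM /V fineK.
- move=> _; exists W; first exact: ltW.
  move=> f e e0 fe /=; apply: ereal_inf_lbound; apply: aeW => x Ox.
  by rewrite lee_fin; apply: ler_pM; rewrite ?cabs_ge0 ?(ltW (w0 _ Ox)) ?wW' ?fe.
Qed.

(* On a null set the essential supremum is [-oo], for every function. *)
Lemma Lp_norm_ge0_or_Ny (Om : set R) (w : R -> R) (p : \bar R) (f : R -> C) :
  (forall x, Om x -> 0 < w x) -> (1 <= p)%E ->
  (0 <= Lp_norm Om w p f)%E \/ (forall g : R -> C, Lp_norm Om w p g = -oo)%E.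
Proof.
move=> w0; case: p => [r| |]// p1; first by left; exact: poweR_ge0.
have [|neg] := leP 0%E (Lp_norm Om w +oo f); [by left|right => g].
have [y ae_y y0] := ereal_inf_lt neg.
apply/eqP; rewrite -leeNy_eq; apply: ereal_inf_lbound.
(* A negative essential bound of a nonnegative function is absurd at each point of [Om] where it
   holds, so almost no point lies in [Om], and -oo is an essential bound for [g]. *)
apply: (@filterS _ _ (ae_filter_ringOfSetsType mu) _ _ _ ae_y) => x fy Ox; exfalso.
have := le_lt_trans (fy Ox) y0; rewrite lte_fin ltNge mulr_ge0 ?cabs_ge0//.
by rewrite ltW// w0.
Qed.

End LpNorm.

Unset Implicit Arguments.

Theorem theorem4p2 (R : realType) (s : seq (R * R)) (w : R -> R)
  (al : R) (p : \bar R) (m : nat) (F : R -> R[i]) :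
  all (fun ab => ab.1 <= ab.2) s ->
  {within Omega_of s, continuous w} ->
  (forall x, Omega_of s x -> 0 < w x) ->
  0 < al < 1 ->
  (1 <= p)%E ->
  (2 <= m)%N ->
  {within Omega_of s, continuous (F : R -> (R[i])^o)} ->
  dist_to (W_alpha (Omega_of s) al) (Omega_of s) w p F =
  dist_to (W_m (Omega_of s) al m) (Omega_of s) w p F.
Proof.
move=> _ cw w0 al01 p1 m2 cF; set Om := Omega_of s.
have cOm : compact Om by exact: compact_Omega_of.
have mOm : measurable Om by exact: compact_measurable.
have fOm : (@lebesgue_measure R Om < +oo)%E by exact: compact_finite_measure.
have [W W0 wW] := compact_norm_bounded cOm cw.
have cid : {within Om, continuous (fun x : R => x)}.
  by apply: continuous_subspaceT => x; exact: cvg_id.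
have [M M0 OmM] := compact_norm_bounded cOm cid.
have [cR cI] := within_continuous_ReIm cF.
have [gR [B [FR gRc gRB]]] := continuous_extension cOm cR.
have [gI [_ [FI gIc _]]] := continuous_extension cOm cI.
have [K K0 HK] := Lp_norm_small mOm fOm w0 wW W0 p1.
have dense (e : R) : 0 < e -> exists2 q, W_m Om al m q &
    (Lp_norm Om w p (fun x => (q x - F x)%R) <= e%:E)%E.
  move=> e0; have K1 : 0 < K + 1 by lra.
  have eK : 0 < e / (K + 1) by rewrite divr_gt0.
  have [t0 [h [n [c [h0 Hc]]]]] := spline_uniform_approx m2 M0
    (continuous_unif_cont_on M gRc) (fun x _ => gRB x)
    (continuous_unif_cont_on (M + 1) gIc) eK.
  exists (fun x => spline_comb t0 h m c x%:C%C); first exact: spline_comb_W_m OmM.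
  apply: le_trans (HK _ _ (ltW eK) _) _.
    move=> x Ox; apply: le_trans (Hc x (OmM x Ox)).
    by rewrite -FR// -FI//; case: (F x).
  by rewrite lee_fin mulrCA ler_piMr ?(ltW e0)// ler_pdivrMr// mul1r; lra.
apply/le_anti/andP; split.
  by apply: le_ereal_inf => _ [q Hq <-]; exists q => //; exact: W_m_W_alpha Hq.
apply: le_ereal_inf_tmp => _ [q _ <-].
(* Either this norm is at least 0, a value that [dense] approaches within [W_m], or all norms are
   -oo at once. *)
have [q0|Ny] := Lp_norm_ge0_or_Ny (fun x => (q x - F x)%R) w0 p1.
  apply: le_trans q0; apply/lee_addgt0Pr => e e0; rewrite add0e.
  have [q' Hq' le_e] := dense e e0; apply: le_trans le_e.
  by apply: ereal_inf_lbound; exists q'.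
have [q' Hq' _] := dense 1 ltr01.
by apply: ereal_inf_lbound; exists q' => //; rewrite !Ny.
Qed.
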